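(* There is an algorithm which, given the canonical basis $\Sigma_C$ of any finite $D$-geometry $\langle G,\phi\rangle$ (a finite convex geometry without $D$-cycles), outputs an optimum basis of $\langle G,\phi\rangle$ in time polynomial in the size $s(\Sigma_C)$.
   Context: All sets are finite. A closure system $\langle G,\phi\rangle$ is a set $G$ with a closure operator $\phi:2^G\to 2^G$; $X$ is closed if $\phi(X)=X$. It is a convex geometry if $\phi(\emptyset)=\emptyset$ and the anti-exchange axiom holds: for all $x\neq y$ in $G$ and all closed $X\subseteq G$, if $x\in\phi(X\cup\{y\})$ and $x\notin X$, then $y\notin\phi(X\cup\{x\})$. Convex geometries are standard: $\phi(\{i\})\setminus\{i\}$ is closed for every $i\in G$. An implication $X\to Y$ is an ordered pair of nonempty disjoint subsets of $G$; it holds in $\langle G,\phi\rangle$ if $Y\subseteq\phi(X)$; it is binary if $|X|=1$, non-binary otherwise. A set $\Sigma$ of implications defines the closure system whose closed sets are the $Z\subseteq G$ such that for all $(X\to Y)\in\Sigma$, $X\subseteq Z$ implies $Y\subseteq Z$. A basis of $\langle G,\phi\rangle$ is a set of implications defining it. The size is $s(\Sigma)=\sum_{(X\to Y)\in\Sigma}(|X|+|Y|)$, and a basis is optimum if its size is minimum among all bases of the closure system. Canonical basis: $Q\subseteq G$ is quasi-closed if it is not closed and $Q\cap X$ is closed for every closed $X$ with $Q\not\subseteq X$. A quasi-closed $C$ is critical if whenever $Q\subseteq C$ is quasi-closed and $\phi(Q)=\phi(C)$, then $Q=C$. With $\mathcal C$ the set of critical sets, $\Sigma_C=\{C\to\phi(C)\setminus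 C: C\in\mathcal C\}$. $D$-basis and $D$-cycles (for a standard closure system): the $D$-basis $\Sigma_D$ consists of all implications $a\to b$ with $b\in\phi(\{a\})\setminus\{a\}$, together with all implications $A\to b$ with $|A|\ge 2$, $b\in\phi(A)\setminus A$, such that for every $a\in A$ and every $C\subseteq\phi(\{a\})\setminus\{a\}$ the implication $(A\setminus\{a\})\cup C\to b$ does not hold, i.e. $b\notin\phi((A\setminus\{a\})\cup C)$. Write $bDa$ if $a\in A$ for some non-binary $(A\to b)\in\Sigma_D$. A $D$-cycle is a sequence $aDa_1D\cdots Da_kDa$. The system is without $D$-cycles if there is no such sequence. *)

(* Defs.v *)
From mathcomp Require Import all_boot all_algebra.

Set Implicit Arguments.
Unset Strict Implicit.
Unset Printing Implicit Defensive.

Section ClosureSystems.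

Variable G : finType.
Implicit Types (phi : {set G} -> {set G}) (A C Q X Y Z : {set G}).

Definition closure_operator phi : Prop :=
  [/\ forall X, X \subset phi X,
      forall X Y, X \subset Y -> phi X \subset phi Y
    & forall X, phi (phi X) = phi X].

Definition closed_set phi X : bool := phi X == X.

Definition convex_geometry phi : Prop :=
  [/\ closure_operator phi,
      phi set0 = set0
    & forall (x y : G) X, x != y -> closed_set phi X ->
        x \in phi (y |: X) -> x \notin X -> y \notin phi (x |: X)].

(* The pair (X, Y) stands for the implication X -> Y. *)
Definition implication : Type := ({set G} * {set G})%type.

Definition is_implication (i : implication) : bool :=
  [&& i.1 != set0, i.2 != set0 & [disjoint i.1 & i.2]].

Definition binary (i : implication) : bool := #|i.1| == 1.

Definition respects (Sigma : {set implication}) Z : bool :=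
  [forall i in Sigma, (i.1 \subset Z) ==> (i.2 \subset Z)].

Definition is_basis phi (Sigma : {set implication}) : Prop :=
  {in Sigma, forall i, is_implication i} /\
  forall Z, closed_set phi Z = respects Sigma Z.

Definition basis_size (Sigma : {set implication}) : nat :=
  \sum_(i in Sigma) (#|i.1| + #|i.2|).

Definition optimum_basis phi (Sigma : {set implication}) : Prop :=
  is_basis phi Sigma /\
  forall Sigma', is_basis phi Sigma' -> basis_size Sigma <= basis_size Sigma'.

Definition quasi_closed phi Q : bool :=
  ~~ closed_set phi Q &&
  [forall X : {set G},
     closed_set phi X && ~~ (Q \subset X) ==> closed_set phi (Q :&: X)].

Definition critical phi C : bool :=
  quasi_closed phi C &&
  [forall Q : {set G},
     [&& Q \subset C, quasi_closed phi Q & phi Q == phi C] ==> (Q == C)].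

Definition canonical_basis phi : {set implication} :=
  [set (C, phi C :\: C) | C : {set G} & critical phi C].

Definition D_minimal phi A (b : G) : bool :=
  [forall a in A, [forall C : {set G},
     (C \subset phi [set a] :\ a) ==> (b \notin phi ((A :\ a) :|: C))]].

Definition D_basis phi : {set implication} :=
  [set ([set a], [set b]) | a : G, b : G in phi [set a] :\ a] :|:
  [set (A, [set b]) | A : {set G} in [pred A : {set G} | 1 < #|A|],
                      b : G in phi A :\: A & D_minimal phi A b].

Definition D_rel phi : rel G := fun b a =>
  [exists A : {set G},
     [&& (A, [set b]) \in D_basis phi, ~~ binary (A, [set b]) & a \in A]].

Definition D_cycle phi (c : seq G) : bool :=
  (c != [::]) && cycle (D_rel phi) c.

Definition D_geometry phi : Prop :=
  convex_geometry phi /\ forall c : seq G, ~~ D_cycle phi c.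

(* A set of implications is presented to (and by) a machine as a
   duplicate-free list, in arbitrary order, of pairs of duplicate-free lists of
   elements; the list of length m is written as m followed by its m items, and
   an element of G as its index, which is less than #|G| and occupies one
   memory word. *)

Definition listing (Sigma : {set implication}) (l : seq (seq G * seq G)) : Prop :=
  let l' := [seq ([set:: p.1], [set:: p.2]) | p <- l] in
  [/\ all (fun p => uniq p.1 && uniq p.2) l, uniq l' & l' =i Sigma].

Definition encode_seq (s : seq G) : seq nat :=
  size s :: [seq nat_of_ord (enum_rank x) | x <- s].

Definition encode (l : seq (seq G * seq G)) : seq nat :=
  size l :: flatten [seq encode_seq p.1 ++ encode_seq p.2 | p <- l].

Definition represents (w : seq nat) (Sigma : {set implication}) : Prop :=
  exists2 l, listing Sigma l & w = encode l.

End ClosureSystems.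

(* The machine of Cook and Reckhow (Time bounded random access machines, 1973)
   over natural numbers (with truncated subtraction), with uniform cost; in
   [IJump i k] the target k is an absolute instruction index.  Since
   addition and subtraction are the only arithmetic operations, a run of t steps on b-bit inputs only handles
   numbers of at most b + t + O(1) bits, so that polynomial time on this machine
   agrees with polynomial time on Turing machines. *)

Inductive instr : Type :=
| IConst of nat & nat
| IAdd of nat & nat & nat
| ISub of nat & nat & nat
| ILoad of nat & nat
| IStore of nat & nat
| IJump of nat & nat
| IRead of nat
| IPrint of nat.

Definition program : Type := seq instr.

Record config : Type := Config {
  pc : nat;
  mem : nat -> nat;
  inp : seq nat;
  out : seq nat
}.

Definition init (w : seq nat) : config := Config 0 (fun _ => 0) w [::].

Definition exec (i : instr) (c : config) : config :=
  let: Config n m u v := c in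
  let set_cell a x := Config n.+1 [eta m with a |-> x] u v in
  match i with
  | IConst i k => set_cell i k
  | IAdd i j k => set_cell i (m j + m k)
  | ISub i j k => set_cell i (m j - m k)
  | ILoad i j => set_cell i (m (m j))
  | IStore i j => set_cell (m i) (m j)
  | IJump i k => Config (if 0 < m i then k else n.+1) m u v
  | IRead i => Config n.+1 [eta m with i |-> head 0 u] (behead u) v
  | IPrint i => Config n.+1 m u (rcons v (m i))
  end.

(* The machine halts when the program counter leaves the program; a halted
   configuration is a fixed point of [step]. *)
Definition step (P : program) (c : config) : config :=
  if onth P (pc c) is Some i then exec i c else c.

Definition outputs_within (P : program) (w : seq nat) (t : nat) (v : seq nat) :
    Prop :=
  let c := iter t (step P) (init w) in size P <= pc c /\ out c = v.

(* Main.v *)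
Require Import Defs.
From mathcomp Require Import all_boot all_algebra.
From mathcomp Require Import zify.

Set Implicit Arguments.
Unset Strict Implicit.
Unset Printing Implicit Defensive.

(** Let [E] be a closed set of a convex geometry with extreme points [K] (the
[k] in [E] for which [E :\ k] is closed; [K] is the least generating set of
[E]). Call an element [b] of [E] indispensable if [b \in phi X] and [X \subset
E :\ b] force [phi X = E]. Suppose that [E = phi C] with [C] critical and that
[b] is indispensable and not in [C]. Then [E :\ b] contains [C], hence is not
closed, so every basis has an implication with its premise inside [E :\ b] and
[b] in its conclusion, and the closure of that premise is [E]. Hence, for every
critical set [C], the implications of the basis whose premise generates [E =
phi C] contain at least one premise of size [#|K|] or more, and their
conclusions cover all indispensable elements outside [C]. These classes of
implications are disjoint for different [E], and critical sets with the same
closure coincide ([critical_inj]), so adding up gives a lower bound for the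
size of every basis ([class_size]).

Without D-cycles the bound is attained. The key point
([generated_by_indispensable]) is that [E] is the only subset of [E] that
contains all indispensable elements and is closed under every implication [X ->
phi X] with [phi X != E]. Consequently the implications [K -> Y], with [Y] the
indispensable elements outside [C], form a basis, and this basis is optimum
([pruned_basis_optimum]).

Since [b] outside [K] is indispensable exactly when [E :\ k :\ b] is closed for
all [k] in [K], both [K] and [Y] are found by testing polynomially many sets
for closedness, and a set is closed iff it respects the canonical basis. Such a
test is a few passes over the given list of implications.

The machine program is obtained from a small language with named registers,
several arrays and counted loops. The language has a total semantics [den] and
a cost function; its compiler is proved correct with exact cost
([compile_correct]), and as all loops of the program run at most as often as
there are element occurrences in the input, the cost is bounded by a polynomial
read off from the syntax ([cost_le_poly]). What the program prints is then
established with loop invariants over the list of element occurrences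
([prune_programP]) and identified with the optimum basis ([output_lists],
[listing_prune]). *)

(** * The optimum basis of a convex geometry without D-cycles *)

Section Geometry.

Variables (G : finType) (phi : {set G} -> {set G}).
Implicit Types (A B C E K Q S X Y Z : {set G}) (a b k u v x y : G).

Hypothesis geo : convex_geometry phi.

Let sub_phi X : X \subset phi X. Proof. by case: geo => -[]. Qed.
Let phiS X Y : X \subset Y -> phi X \subset phi Y.
Proof. by case: geo => -[_ + _] _ _; apply. Qed.
Let phiK X : phi (phi X) = phi X. Proof. by case: geo => -[]. Qed.
Let phi0 : phi set0 = set0. Proof. by case: geo. Qed.

Lemma closed_phi X : closed_set phi (phi X).
Proof. by rewrite /closed_set phiK. Qed.

Lemma closedP Z :
  reflect (forall X, X \subset Z -> phi X \subset Z) (closed_set phi Z).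
Proof.
apply: (iffP eqP) => [<- X /phiS | H]; first by rewrite phiK.
by apply/eqP; rewrite eqEsubset sub_phi H.
Qed.

Lemma closedI X Y :
  closed_set phi X -> closed_set phi Y -> closed_set phi (X :&: Y).
Proof.
move=> /closedP cX /closedP cY; apply/closedP => Z.
by rewrite !subsetI => /andP[/cX -> /cY ->].
Qed.

Lemma phi_gen X Y : X \subset phi Y -> Y \subset X -> phi X = phi Y.
Proof.
by move=> sXY sYX; apply/eqP; rewrite eqEsubset -{1}[phi Y]phiK !phiS.
Qed.

Lemma subset_phi X Y : (X \subset phi Y) = (phi X \subset phi Y).
Proof.
by apply/idP/idP => [/phiS | ]; [rewrite phiK | apply: subset_trans].
Qed.

Lemma phi1_anti a c : c \in phi [set a] -> c != a -> a \notin phi [set c].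
Proof.
move=> ca nca; case: geo => _ _ /(_ c a set0 nca).
by rewrite !setU0 inE; apply=> //; rewrite /closed_set phi0.
Qed.

Lemma phi1_sub a c : c \in phi [set a] -> phi [set c] \subset phi [set a].
Proof. by move=> ca; rewrite -subset_phi sub1set. Qed.

Lemma mem_phi1 a : a \in phi [set a].
Proof. by rewrite -sub1set. Qed.

Definition extremes E : {set G} := [set x in E | closed_set phi (E :\ x)].

Lemma extremes_sub_gen X : extremes (phi X) \subset X.
Proof.
apply/subsetP => x; rewrite inE => /andP[xE /closedP cE]; apply/idPn => nxX.
have /cE/subsetP/(_ x xE) : X \subset phi X :\ x by rewrite subsetD1 sub_phi.
by rewrite !inE eqxx.
Qed.

(** A minimal generating set consists of extreme points: for [x] in such a set
[B], a maximal closed subset of [phi X] that contains [B :\ x] and avoids [x]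
must be [phi X :\ x], because any further point [y] missing from it would
violate anti-exchange with [x]. *)
Lemma phi_extremes X : phi (extremes (phi X)) = phi X.
Proof.
have [|B /eqP BX minB] := @arg_minnP _ X (fun B =>
  phi B == phi X) (fun B : {set G} => #|B|).
  by [].
suff <- : B = extremes (phi X) by [].
apply/eqP; rewrite eqEsubset andbC -{1}BX extremes_sub_gen /=.
apply/subsetP => x xB.
have xE : x \in phi X by rewrite -BX (subsetP (sub_phi B)).
rewrite inE xE /=.
have nx : x \notin phi (B :\ x).
  apply/negP => xD; have : #|B| <= #|B :\ x|.
    apply: minB; rewrite -BX; apply/eqP/esym/phi_gen; last by rewrite subD1set.
    by rewrite -{1}(setD1K xB) subUset sub1set xD sub_phi.
  by rewrite (cardsD1 x B) xB ltnn.
pose ok M := [&& closed_set phi M, B :\ x \subset M,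
  x \notin M & M \subset phi X].
have okB : ok (phi (B :\ x)).
  by rewrite /ok closed_phi sub_phi nx -BX phiS // subD1set.
have [M /and4P[cM sBM xM sME] maxM] := arg_maxnP (fun M : {set G} => #|M|) okB.
suff <- : M = phi X :\ x by [].
apply/eqP; rewrite eqEsubset subsetD1 sME xM /=; apply/subsetP => y.
rewrite !inE => /andP[nyx yE]; apply/idPn => yM.
have sMy : M \subset y |: M by rewrite subsetUr.
have xMy : x \in phi (y |: M).
  apply/idPn => nxM; have /maxM : ok (phi (y |: M)).
    rewrite /ok closed_phi nxM (subset_trans sBM) ?(subset_trans sMy) //=.
    by rewrite -subset_phi subUset sub1set yE.
  apply/negP; rewrite -ltnNge; apply: leq_trans (subset_leq_card (sub_phi _)).
  by rewrite cardsU1 yM.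
case: geo => _ _ /(_ x y M); rewrite eq_sym => /(_ nyx cM xMy xM)/negP; apply.
move: yE; rewrite -BX; apply/subsetP/phiS.
by rewrite -{1}(setD1K xB) setUS.
Qed.

Lemma critical_exists Q :
  quasi_closed phi Q -> exists C, [/\ critical phi C,
    C \subset Q & phi C = phi Q].
Proof.
move=> qQ.
pose ok C := [&& quasi_closed phi C, C \subset Q & phi C == phi Q].
have okQ : ok Q by rewrite /ok qQ subxx eqxx.
have [C /and3P[qC sCQ /eqP eC] minC] := arg_minnP (fun C : {set G} => #|C|) okQ.
exists C; split=> //; rewrite /critical qC /=; apply/forallP => B.
apply/implyP => /and3P[sBC qB /eqP eB]; rewrite eqEcard sBC minC //.
by rewrite /ok qB (subset_trans sBC) // eB eC eqxx.
Qed.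

Lemma quasi_closed_lower C X : quasi_closed phi C ->
  X \subset C -> phi X != phi C -> phi X \subset C.
Proof.
case/andP=> _ /forallP/(_ (phi X)) /implyP qC sXC neq.
rewrite (subset_trans _ (subsetIl C (phi X))) //.
apply/(closedP _ (qC _)); last by rewrite subsetI sXC sub_phi.
rewrite closed_phi; apply: contra neq => sC.
by apply/eqP/esym/phi_gen.
Qed.

(** A closure of minimal cardinality among those of subsets of [Z] that leave
[Z] is the closure of a critical subset of [Z]. This is how both the canonical
basis and the pruned one are shown to be bases. *)
Lemma unclosed_critical Z : ~~ closed_set phi Z ->
  exists C, [/\ critical phi C, C \subset Z, ~~ (phi C \subset Z)
    & forall X, X \subset Z :&: phi C -> phi X != phi C ->
      phi X \subset Z :&: phi C].
Proof.
move=> ncZ.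
pose bad X := (X \subset Z) && ~~ (phi X \subset Z).
have badZ : bad Z.
  by rewrite /bad subxx; apply: contra ncZ => H;
    rewrite /closed_set eqEsubset H sub_phi.
have [X /andP[sXZ nXZ] minX] := arg_minnP (fun X : {set G} => #|phi X|) badZ.
set E := phi X in nXZ minX.
have low B : B \subset Z :&: E -> phi B != E -> phi B \subset Z :&: E.
  rewrite !subsetI => /andP[sBZ sBE] neB.
  have sE : phi B \subset E by rewrite -subset_phi.
  rewrite sE andbT; apply/idPn => nBZ.
  have : #|E| <= #|phi B| by apply: minX; rewrite /bad sBZ.
  by apply/negP; rewrite -ltnNge proper_card // properEneq neB.
have genQ : phi (Z :&: E) = E.
  by apply: phi_gen; rewrite ?subsetIr // subsetI sXZ sub_phi.
have [|C [cC sC eC]] := @critical_exists (Z :&: E).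
  apply/andP; split; first by apply: contra nXZ => /eqP e;
    rewrite -genQ e subsetIl.
  apply/forallP => B; apply/implyP => /andP[cB nB].
  have nE : phi (Z :&: E :&: B) != E.
    apply: contra nB => /eqP eqE; rewrite (subset_trans (subsetIr _ _)) // -eqE.
    by apply/(closedP _ cB)/subsetIr.
  rewrite /closed_set eqEsubset sub_phi andbT subsetI low ?subsetIl //=.
  by apply/(closedP _ cB)/subsetIr.
rewrite genQ in eC; exists C; split; rewrite ?eC //.
by apply: subset_trans sC (subsetIl _ _).
Qed.

Lemma canonical_basisP Z : closed_set phi Z = respects (canonical_basis phi) Z.
Proof.
apply/idP/forall_inP => [/closedP cZ _ /imsetP[C cC ->] | H] /=.
  by apply/implyP => /cZ; apply: subset_trans; rewrite subDset subsetUr.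
apply: contraT => /unclosed_critical[C [cC sCZ /negP nEZ _]]; case: nEZ.
have /H/implyP/(_ sCZ) /= sD : (C, phi C :\: C) \in canonical_basis phi.
  by apply/imsetP; exists C; rewrite ?inE.
by rewrite -(setID (phi C) C) subUset sD (subset_trans (subsetIr _ _)).
Qed.

(** The intersection of two critical sets with closure [E] still contains the
extreme points of [E], hence generates [E], and it inherits quasi-closedness;
minimality then makes both sets equal to it. *)
Lemma critical_inj : {in critical phi &, injective phi}.
Proof.
move=> C1 C2 /andP[q1 /forallP m1] /andP[q2 /forallP m2] e12.
have gen : phi (C1 :&: C2) = phi C1.
  apply/esym/phi_gen; last by rewrite subsetIl.
  rewrite subset_phi -(phi_extremes C1) -subset_phi.
  apply: subset_trans (sub_phi _); rewrite subsetI.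
  by rewrite extremes_sub_gen e12 extremes_sub_gen.
have qI : quasi_closed phi (C1 :&: C2).
  case/andP: (q1) => nc1 /forallP h1; case/andP: (q2) => _ /forallP h2.
  apply/andP; split.
    apply: contra nc1; rewrite /closed_set gen => /eqP e.
    by rewrite eqEsubset sub_phi e subsetIl.
  apply/forallP => X; apply/implyP => /andP[cX].
  move=> nX.
  have nX1 : ~~ (C1 \subset X) by apply: contra nX; apply/subset_trans/subsetIl.
  have nX2 : ~~ (C2 \subset X) by apply: contra nX; apply/subset_trans/subsetIr.
  rewrite -[X in _ :&: X]setIid setIACA closedI //.
    by move/implyP: (h1 X); apply; rewrite cX.
  by move/implyP: (h2 X); apply; rewrite cX.
have /eqP <- : C1 :&: C2 == C1.
  by move/implyP: (m1 (C1 :&: C2)); apply; rewrite subsetIl qI gen eqxx.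
have /eqP -> // : C1 :&: C2 == C2.
by move/implyP: (m2 (C1 :&: C2)); apply; rewrite subsetIr qI gen e12 eqxx.
Qed.

(** The base exceeds the number of elements, so replacing [a] by any number of
elements strictly below [a] decreases the weight; minimizing it produces
premises of the D-basis. *)
Definition weight A : nat := \sum_(a in A) #|G|.+1 ^ #|phi [set a]|.

Lemma weight_exchange a A C : a \in A -> C \subset phi [set a] :\ a ->
  weight ((A :\ a) :|: C) < weight A.
Proof.
move=> aA /subsetP sC; rewrite /weight [X in _ < X](big_setD1 a) //=.
apply: (@leq_ltn_trans (weight (A :\ a) + weight C)).
  rewrite /weight (big_setID (A :\ a)) /= setUK.
  rewrite leq_add2l setDUl setDv set0U [X in _ <= X](big_setID (A :\ a)) /=.
  exact: leq_addl.
rewrite addnC ltn_add2r.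
have pa : 0 < #|phi [set a]| by apply/card_gt0P; exists a; apply: mem_phi1.
apply: (@leq_ltn_trans (\sum_(c in C) #|G|.+1 ^ #|phi [set a]|.-1)).
  apply: leq_sum => c /sC; rewrite !inE => /andP[nca ca].
  rewrite leq_pexp2l // -ltnS prednK // proper_card // properEneq phi1_sub //.
  rewrite andbT; apply: contraNneq (phi1_anti ca nca) => ->; exact: mem_phi1.
rewrite sum_nat_const -{2}(prednK pa) expnS ltn_pmul2r ?expn_gt0 //.
by rewrite ltnS max_card.
Qed.

(** Among the sets that generate [b] and lie below [X], one of minimal weight
is the premise of an implication of the D-basis; it is not a singleton, since
no single element below [X] generates [b]. *)
Lemma D_refine b X :
  b \in phi X -> (forall x, x \in X -> b \notin phi [set x]) ->
  exists A, [/\ A \subset phi X, (forall a, a \in A -> D_rel phi b a),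
    b \in phi A :\: A & D_minimal phi A b].
Proof.
move=> bX nb.
pose N := \bigcup_(x in X) phi [set x].
have nbN : forall y, y \in N -> b \notin phi [set y].
  move=> y /bigcupP[x xX yx]; apply: contra (nb x xX).
  by apply/subsetP/phi1_sub.
have ok0 : (X \subset N) && (b \in phi X).
  by rewrite bX andbT; apply/subsetP => x xX; apply/bigcupP; exists x;
    rewrite ?mem_phi1.
have [A /andP[sAN bA] minA] :=
  @arg_minnP _ X (fun A => (A \subset N) && (b \in phi A)) weight ok0.
have mA : D_minimal phi A b.
  apply/forall_inP => a aA; apply/forall_inP => C sC; apply/negP => bAC.
  have : weight A <= weight ((A :\ a) :|: C).
    apply: minA; rewrite bAC andbT subUset (subset_trans (subD1set _ _) sAN) /=.
    apply: subset_trans sC (subset_trans (subD1set _ _) _).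
    have /bigcupP[x xX ax] := subsetP sAN _ aA.
    by rewrite (subset_trans (phi1_sub ax)) // (bigcup_sup x).
  by rewrite leqNgt weight_exchange.
have nbA : b \notin A by apply: contraTN (mem_phi1 b) => /(subsetP sAN)/nbN.
have cA : 1 < #|A|.
  rewrite ltn_neqAle eq_sym card_gt0; apply/andP; split.
    apply/negP => /cards1P[a eA]; move: bA; rewrite eA; apply/negP/nbN.
    by rewrite -sub1set -eA.
  by apply: contraTneq bA => ->; rewrite phi0 inE.
have inD : b \in phi A :\: A by rewrite inE nbA.
exists A; split=> //.
  apply: subset_trans sAN _; apply/bigcupsP => x xX.
  by rewrite -subset_phi sub1set (subsetP (sub_phi X)).
move=> a aA; apply/existsP; exists A; rewrite aA andbT /binary /= gtn_eqF //
  andbT.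
rewrite inE; apply/orP; right.
by apply: imset2_f; rewrite ?cA // inE inD.
Qed.

Hypothesis acyclic : forall c, ~~ D_cycle phi c.

(** A relation without cycles on a finite set has a minimal element in every
nonempty subset: an element with the fewest successors under the transitive
closure. *)
Lemma D_minimal_elt (T : {set G}) u : u \in T ->
  exists2 u, u \in T & forall v, v \in T -> ~~ D_rel phi u v.
Proof.
move=> uT.
have [x xT minx] := arg_minnP (fun x => #|connect (D_rel phi) x|) uT.
exists x => // v vT; apply/negP => Dxv.
have sub : connect (D_rel phi) v \subset connect (D_rel phi) x.
  by apply/subsetP => z; apply/connect_trans/connect1.
have eqC : connect (D_rel phi) v =i connect (D_rel phi) x.
  by apply/subset_cardP => //; apply/eqP;
    rewrite eqn_leq minx // subset_leq_card.
have : x \in connect (D_rel phi) v by rewrite eqC; apply: connect0.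
case/connectP=> p pp ex.
move: (acyclic (v :: p)); rewrite /D_cycle /= rcons_path pp -ex.
by rewrite Dxv.
Qed.

Definition lower_closed E S :=
  forall X, X \subset S -> phi X != E -> phi X \subset S.

(** Suppose [E] is not contained in [S]. Call [b] tame if, whenever [b] lies in
the closure of a subset [X] of [E] that does not generate [E], it already lies
in the closure of a single element of [X]. A D-minimal element of [E :\: S] is
tame, since the premises inside [E] of its non-binary D-implications lie in
[S]. Take a tame [b] in [E :\: S] with [phi [set b]] as large as possible, and
let [U] be the set of elements [u] with [b \in phi [set u]] and [phi [set u] !=
E]; it avoids [S]. If [U] is reduced to [b], tameness makes [b] indispensable,
so [b] lies in [S]. Otherwise a D-minimal element [u] of [U :\ b] is not tame,
so it has a non-binary D-implication whose premise generates [b] and hence, by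
tameness of [b], meets [U]; the common element can only be [b], and [u] and [b]
then generate each other over the rest of the premise, against anti-exchange.
*)
Lemma generated_by_indispensable E S : closed_set phi E -> lower_closed E S ->
  (forall b, b \in E -> (forall X, X \subset E :\ b -> b \in phi X ->
    phi X = E) ->
     b \in S) ->
  E \subset S.
Proof.
move=> cE lowS ext; have sE X : X \subset E ->
  phi X \subset E by move/closedP: cE; apply.
rewrite -setD_eq0; apply: contraT => /set0Pn[b0 b0T].
pose tame b := [forall X : {set G},
  (X \subset E) && (phi X != E) && (b \in phi X) ==> [exists x in X,
    b \in phi [set x]]].
(* tame as soon as no non-binary D-implication inside a proper closed subset
   of E concludes it *)
have tameP u : u \in E :\: S ->
  (forall A, A \subset E -> phi A != E -> (forall a, a \in A ->
    D_rel phi u a) ->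
     u \in phi A :\: A -> D_minimal phi A u -> False) -> tame u.
  move=> uT H; apply/forallP => X; apply/implyP => /andP[/andP[sX nX] uX].
  apply: contraT => /exists_inPn nu.
  have [A [sA DA uA mA]] := D_refine uX nu.
  case: (H A _ _ DA uA mA); first exact: subset_trans sA (sE _ sX).
  apply: contraNneq nX => eA; rewrite eqEsubset sE //=.
  by rewrite -eA -subset_phi.
have [b1 b1T minb1] := D_minimal_elt b0T.
have tame1 : tame b1.
  apply: tameP => // A sA nA DA; rewrite inE => /andP[_ bA] _.
  have /lowS/(_ nA)/subsetP/(_ _ bA) : A \subset S.
    apply/subsetP => a aA; apply: contraT => aS.
    by move: (minb1 a); rewrite DA // inE aS (subsetP sA) // => /(_ isT).
  by move: b1T; rewrite inE => /andP[/negP].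
have ok1 : (b1 \in E :\: S) && tame b1 by rewrite b1T.
have [b /andP[bT tb] maxb] :=
  @arg_maxnP _ b1 (fun b => (b \in E :\: S) && tame b) (fun b =>
    #|phi [set b]|) ok1.
pose U := [set u in E | (b \in phi [set u]) && (phi [set u] != E)].
have [bE bS] : b \in E /\ b \notin S by move: bT; rewrite inE => /andP[].
have nbE : phi [set b] != E.
  apply: contraNneq bS => eE; apply: ext => // X sX bX; apply/eqP.
  rewrite eqEsubset sE; last by rewrite (subset_trans sX) ?subD1set.
  by rewrite -eE -subset_phi sub1set.
have bU : b \in U by rewrite inE bE mem_phi1.
have UT u : u \in U -> u \in E :\: S.
  rewrite !inE => /and3P[-> bu nu]; rewrite andbT; apply: contra bS => uS.
  by apply: (subsetP (lowS [set u] _ nu)) => //; rewrite sub1set.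
have tbU X : X \subset E -> phi X != E -> b \in phi X ->
  exists2 x, x \in X & x \in U.
  move=> sX nX bX; have /forallP/(_ X) := tb.
  rewrite sX nX bX => /exists_inP[x xX bx]; exists x => //.
  rewrite inE (subsetP sX) // bx; apply: contraNneq nX => eE.
  by rewrite eqEsubset sE //= -eE phiS ?sub1set.
have [Ub | /set0Pn[u0 u0U]] := eqVneq (U :\ b) set0.
  case/negP: bS; apply: ext => // X; rewrite subsetD1 => /andP[sX nbX] bX.
  apply/eqP; apply: contraT => nX; have [x xX xU] := tbU X sX nX bX.
  have : x \in U :\ b by rewrite !inE in xU *; rewrite xU andbT;
    apply: contraNneq nbX => <-.
  by rewrite Ub inE.
have [u] := D_minimal_elt u0U; rewrite in_setD1 => /andP[nub uU] minu.
have: tame u.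
  apply: tameP => [|A sA nA DA]; first exact: UT.
  rewrite inE => /andP[uA uphi] mA.
  have bu : b \in phi [set u] by move: uU; rewrite inE => /and3P[].
  have bA : b \in phi A by apply: subsetP bu; rewrite -subset_phi sub1set.
  have [v vA vU] := tbU A sA nA bA.
  have [ev | nvb] := eqVneq v b; last first.
    by move: (minu v); rewrite in_setD1 nvb vU DA // => /(_ isT).
  rewrite {v}ev in vA vU.
  have nuA : u \notin phi (A :\ b).
    by have /forall_inP/(_ b vA)/forall_inP/(_ set0) := mA;
      rewrite setU0 sub0set; apply.
  case: geo => _ _ /(_ u b (phi (A :\ b)) nub (closed_phi _));
    case/(_ _ nuA)/negP.
    apply: subsetP uphi; apply: phiS.
    by rewrite -{1}(setD1K vA) setUS.
  by apply: subsetP bu; apply: phiS; rewrite subsetUl.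
move=> tu; have /maxb : (u \in E :\: S) && tame u by rewrite UT.
rewrite /= leqNgt => /negP[]; apply: proper_card.
have bu : b \in phi [set u] by move: uU; rewrite inE => /and3P[].
have nu : u \notin phi [set b] by apply: phi1_anti bu _; rewrite eq_sym.
rewrite properEneq phi1_sub // andbT.
by apply: contraNneq nu => ->; apply: mem_phi1.
Qed.

(** The pair of extreme points of [phi C] and indispensable elements outside
[C]; the closedness conditions are the ones that an algorithm can test. *)
Definition prune C : {set G} * {set G} :=
  let K := [set k in C | closed_set phi (phi C :\ k)] in
  (K, [set b in phi C :\: C |
        [forall k in K, closed_set phi (phi C :\ k :\ b)]]).

Definition pruned_basis : {set implication G} :=
  [set prune C | C in critical phi].

Lemma prune1E C : (prune C).1 = extremes (phi C).
Proof.
apply/eqP; rewrite eqEsubset; apply/andP; split; apply/subsetP => x.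
  by rewrite !inE => /andP[/(subsetP (sub_phi C)) -> ->].
move=> xK; rewrite inE (subsetP (extremes_sub_gen C)) //.
by move: xK; rewrite inE => /andP[].
Qed.

Lemma phi_prune C : phi (prune C).1 = phi C.
Proof. by rewrite prune1E phi_extremes. Qed.

(** An indispensable element [b] of [phi C] outside [C] passes the test of
[prune]: a closure that stays inside [phi C :\ k] is proper, so it cannot reach
[b]. *)
Lemma prune_generates C S : C \subset S -> lower_closed (phi C) S ->
  (prune C).2 \subset S -> phi C \subset S.
Proof.
move=> sCS lowS sYS; apply: (generated_by_indispensable (closed_phi C) lowS).
move=> b bE eb; have [/(subsetP sCS) // | nbC] := boolP (b \in C).
apply: (subsetP sYS); rewrite /= inE in_setD nbC bE /=.
apply/forall_inP => k; rewrite inE => /andP[kC ck].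
have kE : k \in phi C by apply: subsetP (sub_phi C) _ kC.
have nE X : X \subset phi C :\ k -> phi X != phi C.
  move/(closedP _ ck); rewrite subsetD1 => /andP[_]; apply: contraNneq => ->;
    exact: kE.
apply/closedP => X sX.
have sXk : X \subset phi C :\ k by apply: subset_trans sX (subD1set _ _).
rewrite subsetD1 (closedP _ ck) //=; apply/negP => bX.
have/eqP := nE _ sXk; apply; apply: eb bX.
by apply: subset_trans sX _; rewrite setSD ?subD1set.
Qed.

Lemma prune2_neq0 C : critical phi C -> (prune C).2 != set0.
Proof.
case/andP=> qC _; case/andP: (qC) => ncC _; apply: contra ncC => /eqP Y0.
rewrite /closed_set eqEsubset sub_phi andbT; apply: prune_generates => //.
  by move=> X; apply: quasi_closed_lower.
by rewrite Y0 sub0set.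
Qed.

Lemma prune1_neq0 C : critical phi C -> (prune C).1 != set0.
Proof.
case/andP=> /andP[ncC _] _; apply: contra ncC => /eqP K0.
have := phi_prune C; rewrite K0 phi0 => e.
rewrite /closed_set eqEsubset sub_phi andbT -e sub0set //.
Qed.

Lemma prune_inj : {in critical phi &, injective prune}.
Proof.
by move=> C1 C2 c1 c2 e; apply: critical_inj => //;
  rewrite -(phi_prune C1) -(phi_prune C2) e.
Qed.

Lemma pruned_basisP : is_basis phi pruned_basis.
Proof.
split=> [_ /imsetP[C cC ->]|Z].
  rewrite /is_implication prune1_neq0 // prune2_neq0 //=.
  rewrite disjoints_subset; apply/subsetP => x; rewrite !inE => /andP[-> _].
  by [].
apply/idP/forall_inP => [/closedP cZ _ /imsetP[C cC ->] | H].
  apply/implyP => /cZ; apply: subset_trans; rewrite phi_prune.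
  by apply/subsetP => x; rewrite !inE => /andP[/andP[]].
apply: contraT => /unclosed_critical[C [cC sCZ nEZ low]].
case/negP: nEZ; apply: subset_trans (subsetIl Z (phi C)).
have sC : C \subset Z :&: phi C by rewrite subsetI sCZ sub_phi.
apply: prune_generates => //.
have sK : (prune C).1 \subset Z.
  by apply: subset_trans sCZ; apply/subsetP => x; rewrite inE => /andP[].
have /H/implyP/(_ sK) sY : prune C \in pruned_basis by apply: imset_f.
rewrite subsetI sY; apply/subsetP => x; rewrite !inE => /andP[/andP[]].
by [].
Qed.

(** The set [phi C :\ b] is not closed, so an implication with premise inside
it concludes [b]. If its premise missed some extreme point [k] of [phi C], it
would lie in the closed set [phi C :\ k :\ b], which would then contain [b]. *)
Lemma prune2_conclusion Sigma C b : is_basis phi Sigma -> b \in (prune C).2 ->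
  exists2 i, i \in Sigma & (phi i.1 == phi C) && (b \in i.2).
Proof.
move=> [_ bS]; rewrite /= inE in_setD => /andP[/andP[nbC bE] /forall_inP ck].
have : ~~ respects Sigma (phi C :\ b).
  rewrite -bS; apply/negP => /closedP/(_ C).
  rewrite subsetD1 sub_phi nbC => /(_ isT)/subsetP/(_ b bE).
  by rewrite !inE eqxx.
case/forall_inPn => i iS; rewrite negb_imply => /andP[s1 s2]; exists i => //.
have : closed_set phi (phi C) by apply: closed_phi.
rewrite bS => /forall_inP/(_ i iS)/implyP.
have s1E : i.1 \subset phi C by apply: subset_trans s1 (subD1set _ _).
move=> /(_ s1E) s2E; apply/andP; split; last first.
  by apply: contraR s2 => nb; rewrite subsetD1 s2E.
have sP : i.2 \subset phi i.1.
  by have := closed_phi i.1; rewrite bS => /forall_inP/(_ i iS)/implyP; apply.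
have bP : b \in phi i.1.
  by apply: (subsetP sP); apply: contraR s2 => nb; rewrite subsetD1 s2E.
rewrite eqEsubset -subset_phi s1E /= -subset_phi.
rewrite subset_phi -phi_prune -subset_phi; apply/subsetP => k kK.
apply: contraT => nk.
have /closedP/(_ i.1) := ck k kK; rewrite !subsetD1 s1E.
have -> : k \notin i.1 by apply: contra nk; apply/subsetP.
have -> : b \notin i.1 by move: s1; rewrite subsetD1 => /andP[].
by move=> /(_ isT); rewrite bP andbF.
Qed.

(** One premise in the class of [C] contains all extreme points of [phi C], and
the conclusions in this class cover the indispensable elements. *)
Lemma class_size Sigma C : is_basis phi Sigma -> critical phi C ->
  #|(prune C).1| + #|(prune C).2| <=
  \sum_(i in Sigma | phi i.1 == phi C) (#|i.1| + #|i.2|).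
Proof.
move=> bS cC; rewrite big_split; apply: leq_add.
  have /set0Pn[b /(prune2_conclusion bS)[i iS /andP[/eqP ei _]]] :=
    prune2_neq0 cC.
  rewrite (bigD1 i) ?iS ?ei ?eqxx //; apply: leq_trans _ (leq_addr _ _).
  by rewrite subset_leq_card // prune1E -ei extremes_sub_gen.
apply: (@leq_trans #|\bigcup_(i in Sigma | phi i.1 == phi C) i.2|).
  apply: subset_leq_card; apply/subsetP => b.
  move/(prune2_conclusion bS)=> [i iS /andP[ei bi]].
  by apply/bigcupP; exists i => //; apply/andP.
elim/big_rec2: _ => [|i n A _ IH]; first by rewrite cards0.
by rewrite (leq_trans (leq_card_setU _ _)) // leq_add2l.
Qed.

Lemma pruned_basis_optimum : optimum_basis phi pruned_basis.
Proof.
split=> [|Sigma bS]; first exact: pruned_basisP.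
rewrite /basis_size big_imset /=; last exact: prune_inj.
apply: (@leq_trans (\sum_(C in critical phi)
    \sum_(i in Sigma | phi i.1 == phi C) (#|i.1| + #|i.2|))).
  by apply: leq_sum => C cC; apply: class_size.
rewrite (exchange_big_dep [in Sigma]) /=; last by move=> ? ? _ /andP[].
apply: leq_sum => i iS.
rewrite sum_nat_const -[X in _ <= X]mul1n leq_mul2r; apply/orP; right.
apply/card_le1_eqP => C1 C2.
by move=> /andP[c1 /andP[_ /eqP e1]] /andP[c2 /andP[_ /eqP e2]];
  apply: critical_inj; rewrite -?e1.
Qed.

End Geometry.

(** * A structured language for the machine *)

(** Registers are the cells of array [0]. [Fetch r a j] and [Store a j r] move
data between register [r] and the cell of array [a] whose index is the value of
register [j]. [Unless r c] runs [c] when register [r] is zero, and [Repeat r c]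
runs [c] as many times as the initial value of [r], so that every command
terminates and its meaning is a total function. *)
Inductive cmd : Type :=
| Const of nat & nat
| Plus of nat & nat & nat
| Minus of nat & nat & nat
| Fetch of nat & nat & nat
| Store of nat & nat & nat
| Read of nat
| Print of nat
| Seq of cmd & cmd
| Unless of nat & cmd
| Repeat of nat & cmd.

Record state : Type := State {
  cells : nat -> nat -> nat;
  input : seq nat;
  output : seq nat
}.

Definition upd (f : nat -> nat -> nat) a i x : nat -> nat -> nat :=
  fun a' i' => if (a' == a) && (i' == i) then x else f a' i'.

Definition reg s r := cells s 0 r.
Definition set_reg s r x := State (upd (cells s) 0 r x) (input s) (output s).

Fixpoint den (c : cmd) (s : state) : state :=
  match c with
  | Const r k => set_reg s r k
  | Plus r i j => set_reg s r (reg s i + reg s j)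
  | Minus r i j => set_reg s r (reg s i - reg s j)
  | Fetch r a j => set_reg s r (cells s a (reg s j))
  | Store a j r =>
      State (upd (cells s) a (reg s j) (reg s r)) (input s) (output s)
  | Read r =>
      State (upd (cells s) 0 r (head 0 (input s))) (behead (input s)) (output s)
  | Print r => State (cells s) (input s) (rcons (output s) (reg s r))
  | Seq c1 c2 => den c2 (den c1 s)
  | Unless r c => if 0 < reg s r then s else den c s
  | Repeat r c => iter (reg s r) (den c) s
  end.

Fixpoint cost (c : cmd) (s : state) : nat :=
  match c with
  | Fetch _ _ _ | Store _ _ _ => 6
  | Seq c1 c2 => cost c1 s + cost c2 (den c1 s)
  | Unless r c => (if 0 < reg s r then 0 else cost c s).+1
  | Repeat r c => \sum_(k < reg s r) (cost c (iter k (den c) s) + 3) + 6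
  | _ => 1
  end.

(** Cell [i] of array [a] sits at address [8 * i + a], with [a < 7]; addresses
congruent to [7] are invisible to commands and hold two scratch cells and one
loop counter for each nesting depth. *)
Definition addr a i := 8 * i + a.
Definition scratch := addr 7 0.
Definition scratch' := addr 7 1.
Definition counter d := addr 7 d.+2.

Definition addr_code a j : seq instr :=
  [:: IAdd scratch (addr 0 j) (addr 0 j); IAdd scratch scratch scratch;
      IAdd scratch scratch scratch; IConst scratch' a;
      IAdd scratch scratch scratch'].

Fixpoint csize (c : cmd) : nat :=
  match c with
  | Fetch _ _ _ | Store _ _ _ => 6
  | Seq c1 c2 => csize c1 + csize c2
  | Unless _ c => (csize c).+1
  | Repeat _ c => csize c + 6
  | _ => 1
  end.

(** Jump targets are absolute, whence the offset [o]. In a loop the counter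
starts at one more than the number of rounds, since control enters at the
decrement that precedes each test. *)
Fixpoint compile (c : cmd) (d o : nat) : seq instr :=
  match c with
  | Const r k => [:: IConst (addr 0 r) k]
  | Plus r i j => [:: IAdd (addr 0 r) (addr 0 i) (addr 0 j)]
  | Minus r i j => [:: ISub (addr 0 r) (addr 0 i) (addr 0 j)]
  | Fetch r a j => rcons (addr_code a j) (ILoad (addr 0 r) scratch)
  | Store a j r => rcons (addr_code a j) (IStore scratch (addr 0 r))
  | Read r => [:: IRead (addr 0 r)]
  | Print r => [:: IPrint (addr 0 r)]
  | Seq c1 c2 => compile c1 d o ++ compile c2 d (o + csize c1)
  | Unless r c => IJump (addr 0 r) (o.+1 + csize c) :: compile c d o.+1
  | Repeat r c =>
      [:: IConst scratch 1; IAdd (counter d) (addr 0 r) scratch;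
          IJump scratch (o + 3 + csize c)]
      ++ compile c d.+1 (o + 3)
      ++ [:: IConst scratch 1; ISub (counter d) (counter d) scratch;
             IJump (counter d) (o + 3)]
  end.

Lemma size_compile c d o : size (compile c d o) = csize c.
Proof.
by elim: c d o => //= [c1 IH1 c2 IH2|r c IH|r c IH] d o;
  rewrite ?size_cat /= ?IH1 ?IH2 ?IH //=; lia.
Qed.

Fixpoint well_formed (c : cmd) : bool :=
  match c with
  | Fetch _ a _ | Store a _ _ => a < 7
  | Seq c1 c2 => well_formed c1 && well_formed c2
  | Unless _ c | Repeat _ c => well_formed c
  | _ => true
  end.

Definition code_at (P : program) o (l : seq instr) :=
  forall j, j < size l -> onth P (o + j) = onth l j.

Lemma code_at_cat P o l1 l2 :
  code_at P o (l1 ++ l2) -> code_at P o l1 /\ code_at P (o + size l1) l2.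
Proof.
move=> H; split=> j jl.
  by rewrite H ?size_cat ?ltn_addr // onth_cat jl.
by rewrite -addnA H ?size_cat ?ltn_add2l // onth_cat ltnNge leq_addr /= addKn.
Qed.

Lemma code_at_cons P o i l :
  code_at P o (i :: l) -> onth P o = Some i /\ code_at P o.+1 l.
Proof.
move=> H; split; first by have := H 0; rewrite addn0; apply.
by move=> j jl; rewrite addSnnS H.
Qed.

Lemma addr_eq a i a' i' : a < 8 -> a' < 8 ->
  (addr a i == addr a' i') = (a == a') && (i == i').
Proof. rewrite /addr => *; lia. Qed.

Definition sim (f : nat -> nat -> nat) (m : nat -> nat) :=
  forall a i, a < 7 -> m (addr a i) = f a i.

Lemma sim_upd f m a i x : a < 7 -> sim f m ->
  sim (upd f a i x) [eta m with addr a i |-> x].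
Proof.
move=> a7 H b j b7 /=; rewrite /upd addr_eq ?(ltn_trans a7) ?(ltn_trans b7) //.
by case: ifP => // _; apply: H.
Qed.

Lemma sim_hidden f m i x : sim f m -> sim f [eta m with addr 7 i |-> x].
Proof.
move=> H b j b7 /=; rewrite addr_eq ?(ltn_trans b7) // ltn_eqF //=.
exact: H.
Qed.

(** A command compiled at depth [d] may use the counters from [d] on, and must
leave those of the enclosing loops alone. *)
Definition keeps d (m m' : nat -> nat) :=
  forall d', d' < d -> m' (counter d') = m (counter d').

Lemma keeps_refl d m : keeps d m m. Proof. by []. Qed.

Lemma keeps_trans d m1 m2 m3 : keeps d m1 m2 -> keeps d m2 m3 -> keeps d m1 m3.
Proof. by move=> h1 h2 d' lt; rewrite h2 // h1. Qed.

Lemma keeps_set d m a i x :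
  (a < 7) || [&& a == 7 & (i < 2) || (d.+2 <= i)] ->
    keeps d m [eta m with addr a i |-> x].
Proof.
move=> H d' lt /=; rewrite addr_eq //; last by lia.
by case: ifP => // /andP[/eqP e /eqP e']; move: H lt; rewrite -e -e'; lia.
Qed.

Definition runs P t o m u v o' m' u' v' :=
  iter t (step P) (Config o m u v) = Config o' m' u' v'.

Lemma runs_trans P t1 t2 o m u v o1 m1 u1 v1 o2 m2 u2 v2 :
  runs P t1 o m u v o1 m1 u1 v1 -> runs P t2 o1 m1 u1 v1 o2 m2 u2 v2 ->
  runs P (t1 + t2) o m u v o2 m2 u2 v2.
Proof. by rewrite /runs addnC iterD => -> ->. Qed.

Lemma runs_step P t o m u v i o1 m1 u1 v1 o2 m2 u2 v2 :
  onth P o = Some i -> exec i (Config o m u v) = Config o1 m1 u1 v1 ->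
  runs P t o1 m1 u1 v1 o2 m2 u2 v2 ->
  runs P t.+1 o m u v o2 m2 u2 v2.
Proof.
move=> Hi e H; rewrite /runs iterSr.
suff -> : step P (Config o m u v) = Config o1 m1 u1 v1 by [].
by rewrite /step [pc _]/= Hi.
Qed.

Lemma addr_code_runs P o m u v a j f : a < 7 ->
  code_at P o (addr_code a j) -> sim f m ->
  exists m', [/\ runs P 5 o m u v (o + 5) m' u v,
    m' scratch = addr a (f 0 j), sim f m' & forall d, keeps d m m'].
Proof.
move=> a7 + H.
do 5![case/code_at_cons => ?]; move=> _.
eexists; split.
- do 5![apply: runs_step; [eassumption | reflexivity |]]. 
  rewrite /runs /= !addnS addn0; reflexivity.
- rewrite /= H // /addr; lia.
- by do !apply: sim_hidden.
- by move=> d; do !(apply: keeps_trans; last by apply: keeps_set);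
    apply: keeps_refl.
Qed.

Lemma compile_correct c : well_formed c -> forall P d o m s,
  code_at P o (compile c d o) -> sim (cells s) m ->
  exists m', [/\ runs P (cost c s) o m (input s) (output s)
                   (o + csize c) m' (input (den c s)) (output (den c s)),
                 sim (cells (den c s)) m' & keeps d m m'].
Proof.
elim: c => [r k|r i j|r i j|r a j|a j r|r|r|c1 IH1 c2 IH2|r c IH|r c IH] /= wf P
  d o m s.
- case/code_at_cons=> Hi _ H; eexists; split.
  + apply: runs_step; [eassumption|reflexivity|rewrite /runs /= addn1;
      reflexivity].
  + exact: sim_upd.
  + exact: keeps_set.
- case/code_at_cons=> Hi _ H; eexists; split.
  + apply: runs_step; [eassumption|reflexivity|rewrite /runs /= addn1;
      reflexivity].
  + by rewrite /= !H //; apply: sim_upd.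
  + exact: keeps_set.
- case/code_at_cons=> Hi _ H; eexists; split.
  + apply: runs_step; [eassumption|reflexivity|rewrite /runs /= addn1;
      reflexivity].
  + by rewrite /= !H //; apply: sim_upd.
  + exact: keeps_set.
- move=> hc H; have [Ha] := @code_at_cat P o (addr_code a j) [:: _] hc.
  case/code_at_cons=> Hi _.
  have [m' [run mS sim' keep]] := addr_code_runs (input s) (output s) wf Ha H.
  eexists; split.
  + apply: (runs_trans (t1 := 5) (t2 := 1) run).
    apply: runs_step; [eassumption|reflexivity|rewrite /runs /= !addnS addn0;
      reflexivity].
  + by rewrite /= mS sim' //; apply: sim_upd.
  + by apply: keeps_trans (keep d) _; apply: keeps_set.
- move=> hc H; have [Ha] := @code_at_cat P o (addr_code a j) [:: _] hc.
  case/code_at_cons=> Hi _.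
  have [m' [run mS sim' keep]] := addr_code_runs (input s) (output s) wf Ha H.
  eexists; split.
  + apply: (runs_trans (t1 := 5) (t2 := 1) run).
    apply: runs_step; [eassumption|reflexivity|rewrite /runs /= !addnS addn0;
      reflexivity].
  + by rewrite /= mS sim' //; apply: sim_upd.
  + by apply: keeps_trans (keep d) _; rewrite mS; apply: keeps_set; rewrite wf.
- case/code_at_cons=> Hi _ H; eexists; split.
  + apply: runs_step; [eassumption|reflexivity|rewrite /runs /= addn1;
      reflexivity].
  + exact: sim_upd.
  + exact: keeps_set.
- case/code_at_cons=> Hi _ H; eexists; split.
  + apply: runs_step; [eassumption|reflexivity|rewrite /runs /= addn1 H //;
      reflexivity].
  + exact: H.
  + exact: keeps_refl.
- case/andP: wf => wf1 wf2 /code_at_cat[h1]; rewrite size_compile => h2 H.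
  have [m1 [run1 sim1 keep1]] := IH1 wf1 _ _ _ _ _ h1 H.
  have [m2 [run2 sim2 keep2]] := IH2 wf2 _ _ _ _ _ h2 sim1.
  exists m2; split=> //; last exact: keeps_trans keep1 keep2.
  by rewrite addnA; apply: runs_trans run1 run2.
- case/code_at_cons=> Hi hc H.
  case: ifPn => [pos|zero].
    exists m; split=> //.
    apply: runs_step; [eassumption|reflexivity|].
    by rewrite H // -/(reg s r) pos /runs /= addSnnS.
  have [m1 [run1 sim1 keep1]] := IH wf _ _ _ _ _ hc H.
  exists m1; split=> //.
  apply: runs_step; [eassumption|reflexivity|].
  by rewrite H // -/(reg s r) (negbTE zero) -addSnnS.
case/code_at_cons=> h1 /code_at_cons[h2] /code_at_cons[h3].
rewrite -[o.+3]addn3 => /code_at_cat[hc]; rewrite size_compile.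
case/code_at_cons=> h4 /code_at_cons[h5] /code_at_cons[h6 _] H.
set test := o + 3 + csize c in h3 h4 h5 h6 *.
have cs : (counter d == scratch) = false by rewrite addr_eq.
(* control is at the decrement that precedes the test, with n rounds to go *)
have loop n : forall s1 m1, m1 (counter d) = n.+1 -> sim (cells s1) m1 ->
    exists m2, [/\ runs P (\sum_(k < n) (cost c (iter k (den c) s1) + 3) + 3)
                     test m1 (input s1) (output s1)
                     test.+3 m2 (input (iter n (den c) s1))
                       (output (iter n (den c) s1)),
                   sim (cells (iter n (den c) s1)) m2 & keeps d m1 m2].
  elim: n => [|n IHn] s1 m1 cnt sim1.
    eexists; split.
    - rewrite big_ord0.
      do 2![apply: runs_step; [eassumption|reflexivity|]].
      apply: runs_step; [eassumption|reflexivity|].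
      rewrite /runs /= eqxx cs cnt /=; reflexivity.
    - by do !apply: sim_hidden.
    - by do !(apply: keeps_trans; last by apply: keeps_set;
        rewrite ?leqnn ?orbT).
  pose m1' : nat -> nat := [eta [eta m1 with scratch |-> 1] with counter d |->
    n.+1].
  have sim1' : sim (cells s1) m1' by do !apply: sim_hidden.
  have keep1' : keeps d m1 m1'.
    by do !(apply: keeps_trans; last by apply: keeps_set; rewrite ?leqnn ?orbT).
  have [m2 [run2 sim2 keep2]] := IH wf _ _ _ _ _ hc sim1'.
  have cnt2 : m2 (counter d) = n.+1 by rewrite keep2 // /m1' /= eqxx.
  have [m3 [run3 sim3 keep3]] := IHn _ _ cnt2 sim2.
  exists m3; split; rewrite ?iterSr //; last first.
    apply: keeps_trans keep1' (keeps_trans _ keep3).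
    by move=> d' lt; apply: keep2; apply: ltnW.
  have -> : \sum_(k < n.+1) (cost c (iter k (den c) s1) + 3) + 3 =
     (cost c s1 + (\sum_(k < n) (cost c (iter k (den c) (den c s1)) + 3)
       + 3)).+3.
    rewrite big_ord_recl /=.
    rewrite (eq_bigr (fun k : 'I_n => cost c (iter k (den c) (den c s1)) + 3)).
      by lia.
    by move=> k _; rewrite -iterSr.
  do 3![apply: runs_step; [eassumption|reflexivity|]].
  rewrite /= eqxx cs cnt subn1 /=.
  exact: runs_trans run2 run3.
pose m1 : nat -> nat := [eta [eta m with scratch |-> 1] with counter d |-> (reg
  s r).+1].
have sim1 : sim (cells s) m1 by do !apply: sim_hidden.
have keep1 : keeps d m m1.
  by do !(apply: keeps_trans; last by apply: keeps_set; rewrite ?leqnn ?orbT).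
have [||m2 [run2 sim2 keep2]] := loop (reg s r) s m1 => //.
  by rewrite /m1 /= eqxx.
exists m2; split=> //; last exact: keeps_trans keep1 keep2.
rewrite -[6]/(3 + 3) !addnA addn3.
do 3![apply: runs_step; [eassumption|reflexivity|]].
have rs : (addr 0 r == scratch) = false by rewrite addr_eq.
rewrite /= rs (eq_sym scratch) cs H // addn1.
move: run2; rewrite /runs /test => ->; congr Config; lia.
Qed.

Fixpoint bounded B (c : cmd) (s : state) : Prop :=
  match c with
  | Seq c1 c2 => bounded B c1 s /\ bounded B c2 (den c1 s)
  | Unless r c => reg s r = 0 -> bounded B c s
  | Repeat r c => reg s r <= B /\
      forall k, k < reg s r -> bounded B c (iter k (den c) s)
  | _ => True
  end.

Fixpoint cost_poly (c : cmd) : {poly nat} :=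
  (match c with
  | Fetch _ _ _ | Store _ _ _ => 6%N%:P
  | Seq c1 c2 => cost_poly c1 + cost_poly c2
  | Unless r c => cost_poly c + 1%N%:P
  | Repeat r c => 'X * (cost_poly c + 3%N%:P) + 6%N%:P
  | _ => 1%N%:P
  end)%R.

Lemma cost_le_poly B c s : bounded B c s -> cost c s <= (cost_poly c).[B]%R.
Proof.
elim: c s => [r k|r i j|r i j|r a j|a j r|r|r|c1 IH1 c2 IH2|r c IH|r c IH] s /=;
  rewrite ?(hornerD, hornerM, hornerX, hornerC) ?natrDE ?natrME //.
- by case=> b1 b2; apply: leq_add; [apply: IH1 | apply: IH2].
- by rewrite addn1 ltnS; case: posnP => [r0 /(_ r0) /IH | ].
case=> rB b; apply: leq_add => //.
apply: (@leq_trans (\sum_(k < reg s r) ((cost_poly c).[B]%R + 3))).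
  by apply: leq_sum => k _; rewrite leq_add2r; apply: IH; apply: b.
by rewrite sum_nat_const card_ord leq_mul2r rB orbT.
Qed.

(** A syntactic over-approximation of the cells that a command writes; for a
concrete command and cell it reduces to a boolean constant, so that frame
conditions hold by computation. *)
Fixpoint touches (c : cmd) a i : bool :=
  match c with
  | Const r _ | Plus r _ _ | Minus r _ _ | Fetch r _ _ | Read r =>
    (a == 0) && (i == r)
  | Store b _ _ => a == b
  | Print _ => false
  | Seq c1 c2 => touches c1 a i || touches c2 a i
  | Unless _ c | Repeat _ c => touches c a i
  end.

Lemma den_frame c s a i : ~~ touches c a i -> cells (den c s) a i = cells s a i.
Proof.
elim: c s => [r k|r x y|r x y|r b j|b j r|r|r|c1 IH1 c2 IH2|r c IH|r c IH] s
  //=;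
  rewrite /upd.
1-4, 6: by move=> /negbTE ->.
- by move=> /negbTE ->.
- by rewrite negb_or => /andP[n1 n2]; rewrite IH2 ?IH1.
- by move=> n; case: ifP => // _; rewrite IH.
- by move=> n; elim: (reg s r) => //= k IHk; rewrite IH.
Qed.

Fixpoint prints (c : cmd) : bool :=
  match c with
  | Print _ => true
  | Seq c1 c2 => prints c1 || prints c2
  | Unless _ c | Repeat _ c => prints c
  | _ => false
  end.

Lemma den_output c s : ~~ prints c -> output (den c s) = output s.
Proof.
elim: c s => //= [c1 IH1 c2 IH2|r c IH|r c IH] s.
- by rewrite negb_or => /andP[n1 n2]; rewrite IH2 ?IH1.
- by move=> n; case: ifP => // _; rewrite IH.
- by move=> n; elim: (reg s r) => //= k IHk; rewrite IH.
Qed.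

(** When the loop registers of a command are never written by it, bounds on
their initial values bound the whole run. *)
Fixpoint loops_over (L : pred nat) (c : cmd) : bool :=
  match c with
  | Seq c1 c2 => loops_over L c1 && loops_over L c2
  | Unless _ c => loops_over L c
  | Repeat r c => L r && loops_over L c
  | _ => true
  end.

Lemma bounded_loops B (L : pred nat) c s : loops_over L c ->
  (forall r, L r -> ~~ touches c 0 r /\ reg s r <= B) -> bounded B c s.
Proof.
elim: c s => //= [c1 IH1 c2 IH2|r c IH|r c IH] s.
- move=> /andP[l1 l2] H; split.
    by apply: IH1 => // r /H; rewrite negb_or => -[/andP[]].
  apply: IH2 => // r /H; rewrite negb_or => -[/andP[n1 n2] rB].
  by rewrite /reg den_frame.
- by move=> l H _; apply: IH.
move=> /andP[Lr l] H; split; first by case: (H r Lr).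
move=> k _; apply: IH => // r' Lr'; have [n rB] := H r' Lr'; split=> //.
by elim: k => //= k IHk; rewrite /reg den_frame.
Qed.

Definition assemble (c : cmd) : program := compile c 0 0.

(** A halted machine stays where it is, so the exact running time can be padded
to the polynomial bound. *)
Lemma assemble_correct c w B : well_formed c ->
  bounded B c (State (fun _ _ => 0) w [::]) ->
  outputs_within (assemble c) w (cost_poly c).[B]%R
    (output (den c (State (fun _ _ => 0) w [::]))).
Proof.
set s := State _ _ _ => wf b.
have [|//|m' [run _ _]] := @compile_correct c wf (assemble c) 0 0 (fun _ =>
  0) s.
  by move=> j _.
rewrite /outputs_within -(subnKC (cost_le_poly b)) addnC iterD.
move: run; rewrite /runs -/(init w) => ->; rewrite add0n.
set n := _ - _; have -> : iter n (step (assemble c))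
    (Config (csize c) m' (input (den c s)) (output (den c s))) =
    Config (csize c) m' (input (den c s)) (output (den c s)).
  elim: n => //= n ->; rewrite /step [pc _]/=.
  by rewrite onth_default // size_compile.
by rewrite size_compile.
Qed.

(** * The program *)

Notation "c1 ;; c2" := (Seq c1 c2) (at level 70, right associativity).

(** Registers and arrays are numerals, so that reading one location after an
update of another one reduces by conversion. The proofs below rely on it
whenever they replace a cell of an updated state by its value, or an invariant
about an updated state by the same invariant about the former state. *)
Notation r_rows := 0 (only parsing).
Notation r_halves := 1 (only parsing).
Notation r_items := 2 (only parsing).
Notation r_one := 3 (only parsing).
Notation r_zero := 4 (only parsing).
Notation r_half := 5 (only parsing).
Notation r_t := 6 (only parsing).
Notation r_u := 7 (only parsing).
Notation r_ok := 8 (only parsing).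
Notation r_good := 9 (only parsing).
Notation r_count := 10 (only parsing).
Notation r_k := 11 (only parsing).
Notation r_b := 12 (only parsing).
Notation r_premise := 13 (only parsing).
Notation r_conclusion := 14 (only parsing).
Notation r_len := 15 (only parsing).
Notation r_j1 := 16 (only parsing).
Notation r_a1 := 17 (only parsing).
Notation r_x1 := 18 (only parsing).
Notation r_j2 := 19 (only parsing).
Notation r_a2 := 20 (only parsing).
Notation r_x2 := 21 (only parsing).
Notation r_j3 := 22 (only parsing).
Notation r_a3 := 23 (only parsing).
Notation r_x3 := 24 (only parsing).

(** An implication is split into two halves, the premise of the [r]-th one
having number [2 r] and its conclusion [2 r + 1]. An item is an occurrence of
an element in a half; [a_half] and [a_elt] hold the half and the element of
each item, [a_mark] is indexed by elements, [a_bad] by halves and [a_sel] by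
items. *)
Notation a_half := 1 (only parsing).
Notation a_elt := 2 (only parsing).
Notation a_mark := 3 (only parsing).
Notation a_bad := 4 (only parsing).
Notation a_sel := 5 (only parsing).

(** The two truncated differences add up to zero exactly for equal values. *)
Definition if_eq a b c :=
  Minus r_t a b ;; Minus r_u b a ;; Plus r_t r_t r_u ;; Unless r_t c.
Definition if_one r c := Minus r_t r_one r ;; Unless r_t c.
Definition each j a x c :=
  Const j 0 ;;
  Repeat r_items (Fetch a a_half j ;; Fetch x a_elt j ;; c ;; Plus j j r_one).

(** The test whether the elements of the implication with halves [r_premise]
and [r_conclusion], without the elements [r_k] and [r_b], form a closed set.
Elements of this set are marked, a half is flagged as bad if it contains an
unmarked element, and the set is closed unless some implication has a good
premise and a bad conclusion. *)
Definition clear_marks := each r_j3 r_a3 r_x3 (Store a_mark r_x3 r_zero).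
Definition set_marks :=
  each r_j3 r_a3 r_x3
    (if_eq r_a3 r_premise (Store a_mark r_x3 r_one) ;;
     if_eq r_a3 r_conclusion (Store a_mark r_x3 r_one)).
Definition clear_flags :=
  Const r_half 0 ;;
  Repeat r_halves (Store a_bad r_half r_zero ;; Plus r_half r_half r_one).
Definition set_flags :=
  each r_j3 r_a3 r_x3
    (Fetch r_t a_mark r_x3 ;; Unless r_t (Store a_bad r_a3 r_one)).
Definition read_flags :=
  Const r_ok 1 ;; Const r_half 0 ;;
  Repeat r_rows
    (Fetch r_t a_bad r_half ;; Plus r_half r_half r_one ;;
     Fetch r_u a_bad r_half ;; Plus r_half r_half r_one ;;
     Minus r_u r_one r_u ;; Plus r_t r_t r_u ;; Unless r_t (Const r_ok 0)).

Definition test :=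
  clear_marks ;; set_marks ;;
  Store a_mark r_k r_zero ;; Store a_mark r_b r_zero ;;
  clear_flags ;; set_flags ;; read_flags.

Definition select_premise :=
  each r_j1 r_a1 r_x1 (if_eq r_a1 r_premise
    (Plus r_k r_x1 r_zero ;; Plus r_b r_x1 r_zero ;; test ;;
      Store a_sel r_j1 r_ok)).

Definition check_premise :=
  Fetch r_u a_sel r_j2 ;;
  if_one r_u (Plus r_k r_x2 r_zero ;; test ;; Unless r_ok (Const r_good 0)).

Definition select_conclusion :=
  each r_j1 r_a1 r_x1 (if_eq r_a1 r_conclusion
    (Plus r_b r_x1 r_zero ;; Const r_good 1 ;;
     each r_j2 r_a2 r_x2 (if_eq r_a2 r_premise check_premise) ;;
     Store a_sel r_j1 r_good)).

(** An item of a premise is selected if it is an extreme point, an item of a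
conclusion if it is indispensable; the second choice uses the first. *)
Definition select :=
  Const r_premise 0 ;;
  Repeat r_rows
    (Plus r_conclusion r_premise r_one ;; select_premise ;;
     select_conclusion ;; Plus r_premise r_conclusion r_one).

Definition for_selected c :=
  each r_j1 r_a1 r_x1
    (if_eq r_a1 r_premise (Fetch r_u a_sel r_j1 ;; if_one r_u c)).

Definition write :=
  Print r_rows ;; Const r_premise 0 ;;
  Repeat r_halves
    (Const r_count 0 ;; for_selected (Plus r_count r_count r_one) ;;
     Print r_count ;; for_selected (Print r_x1) ;;
     Plus r_premise r_premise r_one).

Definition read_item :=
  Read r_x1 ;; Store a_half r_items r_half ;; Store a_elt r_items r_x1 ;;
  Plus r_items r_items r_one.

Definition read :=
  Read r_rows ;; Const r_one 1 ;; Plus r_halves r_rows r_rows ;;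
  Repeat r_halves
    (Read r_len ;; Repeat r_len read_item ;; Plus r_half r_half r_one).

Definition prune_program := read ;; select ;; write.

Lemma wf_prune : well_formed prune_program. Proof. by []. Qed.

Lemma reg_set s r v : reg (set_reg s r v) r = v.
Proof. by rewrite /reg /= /upd !eqxx. Qed.

Lemma reg_set_neq s r r' v : r' != r -> reg (set_reg s r v) r' = reg s r'.
Proof. by rewrite /reg /= /upd /= => /negbTE ->. Qed.

Lemma den_seq c1 c2 s : den (c1 ;; c2) s = den c2 (den c1 s).
Proof. by []. Qed.

Lemma den_unless r c s :
  den (Unless r c) s = if 0 < reg s r then s else den c s.
Proof. by []. Qed.

Lemma if_eq_ind (P : state -> Prop) a b c s : 7 < a -> 7 < b ->
  (forall v w x, let s' := set_reg (set_reg (set_reg s r_t v) r_u w) r_t x in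
     reg s a = reg s b -> P (den c s')) ->
  (forall v w x, let s' := set_reg (set_reg (set_reg s r_t v) r_u w) r_t x in
     reg s a <> reg s b -> P s') ->
  P (den (if_eq a b c) s).
Proof.
move=> a7 b7 Pe Pn.
set s1 := set_reg s r_t (reg s a - reg s b).
set s2 := set_reg s1 r_u (reg s1 b - reg s1 a).
set s3 := set_reg s2 r_t (reg s2 r_t + reg s2 r_u).
rewrite -[den _ _]/(if 0 < reg s3 r_t then s3 else den c s3).
have [ea eb] : reg s1 a = reg s a /\ reg s1 b = reg s b.
  by split; rewrite reg_set_neq // gtn_eqF // ltnW.
have -> : (0 < reg s3 r_t) = (reg s a != reg s b).
  rewrite /s3 reg_set {2}/s2 reg_set ea eb.
  by rewrite -[reg s2 r_t]/(reg s a - reg s b); lia.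
by case: (eqVneq (reg s a)) => [/Pe|/eqP/Pn]; apply.
Qed.

Lemma if_one_ind (P : state -> Prop) (b : bool) r c s : reg s r_one = 1 ->
  reg s r = b ->
  (forall v, b -> P (den c (set_reg s r_t v))) ->
  (forall v, ~~ b -> P (set_reg s r_t v)) ->
  P (den (if_one r c) s).
Proof.
move=> e1 er P1 P0; pose s1 := set_reg s r_t (reg s r_one - reg s r).
rewrite -[den _ _]/(if 0 < reg s1 r_t then s1 else den c s1) reg_set /s1 e1 er.
by case: b er P1 P0 => /= er P1 P0; [apply: P1 | apply: P0].
Qed.

Section Loaded.

Variables (m : nat) (its : seq (nat * nat)).

Definition loaded (s : state) : Prop :=
  [/\ reg s r_rows = m, reg s r_halves = m.*2, reg s r_items = size its,
      reg s r_one = 1 /\ reg s r_zero = 0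
    & forall j, j < size its ->
        (cells s a_half j, cells s a_elt j) = nth (0, 0) its j].

Definition keeps_data c :=
  ~~ has (touches c 0) [:: r_rows; r_halves; r_items; r_one; r_zero] &&
  ~~ (touches c a_half 0 || touches c a_elt 0).

Lemma touches_array c a i i' : 0 < a -> touches c a i = touches c a i'.
Proof.
by case: a => // a _; elim: c => //= [c1 -> c2 ->].
Qed.

Lemma loaded_frame c s : keeps_data c -> loaded s -> loaded (den c s).
Proof.
case/andP=> /hasPn rs; rewrite negb_or => /andP[no ne] [e1 e2 e3 [e4 e5] e6].
split; rewrite /reg ?den_frame ?rs //.
by move=> j jl; rewrite !den_frame ?e6 // (touches_array _ _ 0).
Qed.

Lemma loop_ind (I : nat -> state -> Prop) r c s :
  I 0 s -> (forall k s', k < reg s r -> I k s' -> I k.+1 (den c s')) ->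
  I (reg s r) (den (Repeat r c) s).
Proof.
move=> I0 step /=; have le := leqnn (reg s r); move: {1 3 4}(reg s r) le => n.
by elim: n => //= n IH lt; apply: step => //; apply: IH; apply: ltnW.
Qed.

(** Reasoning about a pass over the items amounts to an invariant on the list
of items already visited. The invariant must not depend on the three registers
that drive the pass. *)
Lemma each_ind (I : seq (nat * nat) -> state -> Prop) j a x c s :
  [&& 4 < j, 4 < a, 4 < x & uniq [:: j; a; x]] ->
  keeps_data c -> ~~ touches c 0 j ->
  (forall r, r \in [:: j; a; x] -> forall p s' v, I p s' ->
    I p (set_reg s' r v)) ->
  loaded s -> I [::] s ->
  (forall p i q s', its = p ++ i :: q -> loaded s' -> reg s' j = size p ->
     reg s' a = i.1 -> reg s' x = i.2 -> I p s' -> I (rcons p i) (den c s')) ->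
  I its (den (each j a x c) s).
Proof.
case/and4P=> j4 a4 x4; rewrite /= !inE !negb_or -!andbA => /and4P[ja jx ax _].
move=> kd nj stab ld I0 step.
have ld_set r v s' : 4 < r -> loaded s' -> loaded (set_reg s' r v).
  by move=> r4; case=> ? ? ? [? ?] ?; do 5?[case: r r4 => // r r4]; split=> //;
    split.
pose J k s' := [/\ loaded s', reg s' j = k & I (take k its) s'].
have sz : size its = reg (set_reg s j 0) r_items.
  by case: (ld_set j 0 s j4 ld).
rewrite -{1}[its]take_size sz.
suff [_ _] : J (reg (set_reg s j 0) r_items) (den (each j a x c) s) by [].
apply: (@loop_ind J r_items (Fetch a a_half j ;; Fetch x a_elt j ;; c ;;
  Plus j j r_one)
  (set_reg s j 0)).
  split; first exact: ld_set.
    by rewrite /reg /= /upd !eqxx.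
  by rewrite take0; apply: (stab); rewrite ?inE ?eqxx.
move=> k s' ltk [ld' jk Ik]; rewrite -sz in ltk.
set s1 := set_reg s' a (cells s' a_half (reg s' j)).
set s2 := set_reg s1 x (cells s1 a_elt (reg s1 j)).
rewrite -[den _ _]/(set_reg (den c s2) j (reg (den c s2) j + reg (den c s2)
  r_one)).
have ld1 : loaded s1 by apply: ld_set.
have ld2 : loaded s2 by apply: ld_set.
have e_data : (cells s' a_half k, cells s' a_elt k) = nth (0, 0) its k.
  by case: ld' => _ _ _ _; apply.
have ej1 : reg s1 j = k by rewrite /s1 /reg /= /upd (negbTE ja) andbF.
have ej2 : reg s2 j = k by rewrite /s2 /reg /= /upd (negbTE jx) andbF.
have I2 : I (take k its) s2.
  by do 2![apply: (stab); first by rewrite !inE eqxx ?orbT].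
have dec : its = take k its ++ nth (0, 0) its k :: drop k.+1 its.
  by rewrite -drop_nth // cat_take_drop.
have szk : size (take k its) = k by rewrite size_take ltk.
have := step _ _ _ s2 dec ld2 _ _ _ I2; rewrite szk => /(_ ej2).
have -> : reg s2 a = (nth (0, 0) its k).1.
  rewrite -e_data /s2 /s1 /reg /= /upd (negbTE ax) andbF /= eqxx.
  by rewrite -/(reg s' j) jk.
have -> : reg s2 x = (nth (0, 0) its k).2.
  by rewrite -e_data /s2 reg_set ej1.
move=> /(_ erefl erefl) I3; split.
- by apply: ld_set => //; apply: loaded_frame.
- have [_ _ _ [e1 _] _] := loaded_frame kd ld2.
  have ej : reg (den c s2) j = k by rewrite /reg den_frame.
  by rewrite reg_set e1 ej addn1.
- rewrite (take_nth (0, 0)) //; apply: (stab) => //; by rewrite inE eqxx.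
Qed.

(** Membership of [x] in the set under test, for the implication whose premise
is half [g]. *)
Definition keep g k b x : bool :=
  [&& has (fun i => ((i.1 == g) || (i.1 == g.+1)) && (i.2 == x)) its,
    x != k & x != b].

Definition half_kept g k b g' : bool :=
  all (fun i => (i.1 == g') ==> keep g k b i.2) its.

Definition kept_closed g k b : bool :=
  all (fun r => half_kept g k b r.*2 ==> half_kept g k b r.*2.+1) (iota 0 m).

Lemma clear_marksP s : loaded s ->
  forall i, i \in its -> cells (den clear_marks s) a_mark i.2 = 0.
Proof.
move=> ld.
pose I (p : seq (nat * nat)) s' := forall i, i \in p -> cells s' a_mark i.2 = 0.
apply: (each_ind (I := I)) => //.
move=> p i q s' _ [_ _ _ [_ e0] _] _ _ ex Ip k.
rewrite mem_rcons inE => /predU1P[->|kp] /=; rewrite /upd /= ex e0 ?eqxx //.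
by case: ifP => // _; apply: Ip.
Qed.

Lemma set_marksP s g : loaded s -> reg s r_premise = g ->
  reg s r_conclusion = g.+1 ->
  (forall i, i \in its -> cells s a_mark i.2 = 0) ->
  forall i, i \in its -> cells (den set_marks s) a_mark i.2 =
    has (fun k => ((k.1 == g) || (k.1 == g.+1)) && (k.2 == i.2)) its.
Proof.
move=> ld e0 e1 c0.
pose I (p : seq (nat * nat)) s' := [/\ reg s' r_premise = g,
  reg s' r_conclusion = g.+1 &
  forall i, i \in its -> cells s' a_mark i.2 =
    has (fun k => ((k.1 == g) || (k.1 == g.+1)) && (k.2 == i.2)) p].
suff [] : I its (den set_marks s) by [].
apply: (each_ind (I := I)) => //.
  by move=> r; rewrite !inE => /or3P[] /eqP ->.
move=> p i q s' _ [_ _ _ [eone _] _] _ ea ex [f0 f1 Ip].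
pose c g' := if_eq r_a3 g' (Store a_mark r_x3 r_one).
rewrite -[den _ _]/(den (c r_conclusion) (den (c r_premise) s')).
apply: (@if_eq_ind (fun s => I (rcons p i) (den (c r_conclusion) s))) =>
  // v w x s1; rewrite ea f0 => eg.
all: apply: if_eq_ind => // v' w' x' s2.
- change (reg s' r_a3 = reg s' r_conclusion ->
    I (rcons p i) (den (Store a_mark r_x3 r_one) s2)).
  by rewrite ea f1 eg => /n_Sn.
- move=> _; split=> // k kin.
  rewrite -[LHS]/(if k.2 == reg s' r_x3 then reg s' r_one else cells s' a_mark
    k.2).
  by rewrite ex eone Ip // has_rcons eg eqxx eq_sym /=; case: eqP.
- change (reg s' r_a3 = reg s' r_conclusion ->
    I (rcons p i) (den (Store a_mark r_x3 r_one) s2)).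
  rewrite ea f1 => eg1; split=> // k kin.
  rewrite -[LHS]/(if k.2 == reg s' r_x3 then reg s' r_one else cells s' a_mark
    k.2).
  by rewrite ex eone Ip // has_rcons eg1 eqxx orbT eq_sym /=; case: eqP.
- change (reg s' r_a3 <> reg s' r_conclusion -> I (rcons p i) s2).
  rewrite ea f1 => eg1; split=> // k kin.
  rewrite -[LHS]/(cells s' a_mark k.2) Ip // has_rcons.
  by move/eqP/negbTE: eg => ->; move/eqP/negbTE: eg1 => ->.
Qed.

Lemma clear_flagsP s : loaded s ->
  forall g, g < m.*2 -> cells (den clear_flags s) a_bad g = 0.
Proof.
move=> ld; have [_ e2 _ [e1 e0] _] := ld.
pose I k s' := [/\ reg s' r_half = k, reg s' r_one = 1, reg s' r_zero = 0 &
  forall g, g < k -> cells s' a_bad g = 0].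
suff [] : I (reg s r_halves) (den clear_flags s) by rewrite e2.
apply: (@loop_ind I r_halves (Store a_bad r_half r_zero ;;
  Plus r_half r_half r_one) (set_reg s r_half 0)) => //.
move=> k s' _ [f f1 f0 Ik]; split=> //.
  by rewrite -[LHS]/(reg s' r_half + reg s' r_one) f f1 addn1.
move=> g; rewrite ltnS leq_eqVlt.
rewrite -[cells _ _ _]/(if g == reg s' r_half then reg s' r_zero else cells s'
  a_bad g) f f0.
by case: eqP => //= _; apply: Ik.
Qed.

Lemma set_flagsP s (f : nat -> bool) : loaded s ->
  (forall i, i \in its -> cells s a_mark i.2 = f i.2) ->
  (forall g, g < m.*2 -> cells s a_bad g = 0) ->
  forall g, g < m.*2 ->
    cells (den set_flags s) a_bad g = ~~ all (fun i => (i.1 == g) ==>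
      f i.2) its.
Proof.
move=> ld cm cb.
pose I (p : seq (nat * nat)) s' :=
  (forall i, i \in its -> cells s' a_mark i.2 = f i.2) /\
  forall g, g < m.*2 -> cells s' a_bad g = ~~ all (fun i => (i.1 == g) ==>
    f i.2) p.
suff [] : I its (den set_flags s) by [].
apply: (each_ind (I := I)) => //.
move=> p i q s' eits [_ _ _ [eone _] _] _ ea ex [Im Ib].
have iin : i \in its by rewrite eits mem_cat mem_head orbT.
pose s1 := set_reg s' r_t (cells s' a_mark (reg s' r_x3)).
rewrite -[den _ _]/(if 0 < reg s1 r_t then s1 else den (Store a_bad r_a3 r_one)
  s1).
rewrite reg_set ex Im // lt0b; case: ifPn => fi; split=> // g gm.
  rewrite -[LHS]/(cells s' a_bad g) Ib // all_rcons fi implybT //.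
rewrite -[LHS]/(if g == reg s' r_a3 then reg s' r_one else cells s' a_bad g).
rewrite ea eone Ib // all_rcons (negbTE fi) implybF eq_sym.
by case: eqP.
Qed.

Lemma read_flagsP s (f : nat -> bool) : loaded s ->
  (forall g, g < m.*2 -> cells s a_bad g = ~~ f g) ->
  reg (den read_flags s) r_ok = all (fun r => f r.*2 ==> f r.*2.+1) (iota 0 m).
Proof.
move=> ld cb; have [em _ _ [eone _] _] := ld.
pose I k s' := [/\ reg s' r_half = k.*2, reg s' r_one = 1,
  forall g, g < m.*2 -> cells s' a_bad g = ~~ f g &
  reg s' r_ok = all (fun r => f r.*2 ==> f r.*2.+1) (iota 0 k)].
suff [] : I (reg s r_rows) (den read_flags s) by rewrite em.
pose body := Fetch r_t a_bad r_half ;; Plus r_half r_half r_one ;;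
  Fetch r_u a_bad r_half ;; Plus r_half r_half r_one ;;
  Minus r_u r_one r_u ;; Plus r_t r_t r_u ;; Unless r_t (Const r_ok 0).
apply: (@loop_ind I r_rows body (set_reg (set_reg s r_ok 1) r_half 0)) => //.
rewrite -[reg _ _]/(reg s r_rows) em.
move=> k s' km [eh e1 Ib Iok].
pose v := cells s' a_bad (reg s' r_half).
pose w := cells s' a_bad (reg s' r_half + reg s' r_one).
pose s1 := set_reg (set_reg (set_reg (set_reg (set_reg (set_reg s'
   r_t v) r_half (reg s' r_half + reg s' r_one)) r_u w)
     r_half (reg s' r_half + reg s' r_one + reg s' r_one))
   r_u (reg s' r_one - w)) r_t (v + (reg s' r_one - w)).
rewrite -[den _ _]/(if 0 < v + (reg s' r_one - w)
  then s1 else den (Const r_ok 0) s1).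
have ev : v = ~~ f k.*2 by rewrite /v eh Ib // ltn_double.
have ew : w = ~~ f k.*2.+1.
  by rewrite /w eh e1 addn1 Ib // ltn_Sdouble.
have ehh : reg s' r_half + reg s' r_one + reg s' r_one = k.+1.*2.
  by rewrite eh e1 !addn1 doubleS.
have -> : (0 < v + (reg s' r_one - w)) = (f k.*2 ==> f k.*2.+1).
  by rewrite ev ew e1; case: (f k.*2); case: (f k.*2.+1).
have iotaS : iota 0 k.+1 = rcons (iota 0 k) k by rewrite -addn1 iotaD cats1.
case: ifPn => fk; split=> //; rewrite iotaS all_rcons.
  by rewrite fk.
by rewrite (negbTE fk).
Qed.

Lemma testP s g : loaded s -> reg s r_premise = g ->
  reg s r_conclusion = g.+1 ->
  reg (den test s) r_ok = kept_closed g (reg s r_k) (reg s r_b).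
Proof.
move=> ld e0 e1.
set k := reg s r_k; set b := reg s r_b.
pose s1 := den clear_marks s; have ld1 : loaded s1 by apply: loaded_frame.
pose s2 := den set_marks s1; have ld2 : loaded s2 by apply: loaded_frame.
pose s3 := den (Store a_mark r_k r_zero) s2;
  have ld3 : loaded s3 by apply: loaded_frame.
pose s4 := den (Store a_mark r_b r_zero) s3;
  have ld4 : loaded s4 by apply: loaded_frame.
pose s5 := den clear_flags s4; have ld5 : loaded s5 by apply: loaded_frame.
pose s6 := den set_flags s5; have ld6 : loaded s6 by apply: loaded_frame.
have -> : den test s = den read_flags s6 by rewrite /test 6!den_seq.
have c1 := clear_marksP ld.
have c2 : forall i, i \in its -> cells s2 a_mark i.2 =
    has (fun k => ((k.1 == g) || (k.1 == g.+1)) && (k.2 == i.2)) its.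
  by apply: set_marksP => //; rewrite /reg den_frame.
have c4 : forall i, i \in its -> cells s4 a_mark i.2 = keep g k b i.2.
  move=> i iin.
  have ek : reg s2 r_k = k by rewrite /reg !den_frame.
  have eb : reg s2 r_b = b by rewrite /reg !den_frame.
  have ez : reg s2 r_zero = 0 by case: ld2 => _ _ _ [].
  rewrite -[LHS]/(if i.2 == reg s2 r_b then reg s2 r_zero else
    if i.2 == reg s2 r_k then reg s2 r_zero else cells s2 a_mark i.2).
  rewrite ek eb ez c2 // /keep.
  by case: (i.2 == b); case: (i.2 == k); rewrite ?andbF ?andbT.
have c5 : forall i, i \in its -> cells s5 a_mark i.2 = keep g k b i.2.
  by move=> i iin; rewrite /s5 den_frame // c4.
apply: (read_flagsP (f := half_kept g k b) ld6).
by apply: set_flagsP => //; apply: clear_flagsP.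
Qed.

Definition chosen (i : nat * nat) : bool :=
  if odd i.1 then
    all (fun k => (k.1 == i.1.-1) && kept_closed i.1.-1 k.2 k.2 ==>
                  kept_closed i.1.-1 k.2 i.2) its
  else kept_closed i.1 i.2 i.2.

(** [D] tells which items have been treated so far, by position and half. *)
Definition decided (D : nat -> nat -> bool) (s : state) : Prop :=
  forall j, j < size its -> D j (nth (0, 0) its j).1 ->
    cells s a_sel j = chosen (nth (0, 0) its j).

Lemma decided_sub (D D' : nat -> nat -> bool) s :
  (forall j g, j < size its -> D' j g -> D j g) -> decided D s -> decided D' s.
Proof. by move=> sub ds j jl /(sub _ _ jl); apply: ds. Qed.

Lemma decided_store (D : nat -> nat -> bool) p i q s s' :
  its = p ++ i :: q ->
  (forall j, cells s' a_sel j = if j == size p then chosen i : nat else cells s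
    a_sel j) ->
  decided (fun j g => D j g || (g == i.1) && (j < size p)) s ->
  decided (fun j g => D j g || (g == i.1) && (j < (size p).+1)) s'.
Proof.
move=> eits es ds j jl; rewrite es; case: (eqVneq j (size p)) => [->|nj].
  by rewrite eits nth_cat ltnn subnn.
move=> Dj; apply: ds => //; move: Dj; case: (D j _) => //=.
by rewrite ltnS leq_eqVlt; rewrite (negbTE nj).
Qed.

Lemma decided_skip (D : nat -> nat -> bool) p i q g0 s :
  its = p ++ i :: q -> i.1 <> g0 ->
  decided (fun j g => D j g || (g == g0) && (j < size p)) s ->
  decided (fun j g => D j g || (g == g0) && (j < (size p).+1)) s.
Proof.
move=> eits ni ds j jl Dj; apply: ds => //; move: Dj; case: (D j _) => //=.
rewrite ltnS leq_eqVlt; case: (eqVneq j (size p)) => // ->.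
by rewrite eits nth_cat ltnn subnn; move/eqP/negbTE: ni => ->.
Qed.

Lemma select_premiseP s r : loaded s -> reg s r_premise = r.*2 ->
  reg s r_conclusion = r.*2.+1 ->
  decided (fun _ g => g < r.*2) s ->
  decided (fun _ g => g < r.*2.+1) (den select_premise s).
Proof.
move=> ld e0 e1 ds; set g := r.*2 in e0 e1 ds *.
pose I (p : seq (nat * nat)) s' := [/\ reg s' r_premise = g,
  reg s' r_conclusion = g.+1 &
  decided (fun j g' => (g' < g) || (g' == g) && (j < size p)) s'].
suff [_ _] : I its (den select_premise s).
  by move=> d; apply: (decided_sub _ d) => j g' jl;
    rewrite ltnS leq_eqVlt jl andbT orbC.
apply: (each_ind (I := I)) => //.
- by move=> r'; rewrite !inE => /or3P[] /eqP ->.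
- by split=> //; apply: (decided_sub _ ds) => j g' _; rewrite andbF orbF.
move=> p i q s' eits ld' ej ea ex [f0 f1 Ip].
apply: if_eq_ind => // v w y s1; rewrite ea f0 => eg; last first.
  split=> //; rewrite size_rcons; exact: decided_skip eits eg Ip.
pose s2 := set_reg s1 r_k (reg s1 r_x1 + reg s1 r_zero).
pose s3 := set_reg s2 r_b (reg s2 r_x1 + reg s2 r_zero).
have ez : reg s' r_zero = 0 by case: ld' => _ _ _ [].
have ek : reg s3 r_k = i.2 by rewrite -[LHS]/(reg s' r_x1 + reg s' r_zero)
  ex ez addn0.
have eb : reg s3 r_b = i.2 by rewrite -[LHS]/(reg s' r_x1 + reg s' r_zero)
  ex ez addn0.
have ld3 : loaded s3 by [].
have := testP ld3 (g := g) f0 f1; rewrite ek eb.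
have -> : den (Plus r_k r_x1 r_zero ;; Plus r_b r_x1 r_zero ;; test ;;
  Store a_sel r_j1 r_ok) s1 =
  den (Store a_sel r_j1 r_ok) (den test s3) by rewrite 3!den_seq.
have gh0 : reg (den test s3) r_premise = g by rewrite /reg den_frame.
have gh1 : reg (den test s3) r_conclusion = g.+1 by rewrite /reg den_frame.
have gj : reg (den test s3) r_j1 = size p by rewrite /reg den_frame.
have gsel j : cells (den test s3) a_sel j =
  cells s' a_sel j by rewrite den_frame.
move: (den test s3) gh0 gh1 gj gsel => s4 gh0 gh1 gj gsel eok; split=> //.
rewrite size_rcons -eg; apply: (decided_store (s := s') eits);
  last by rewrite eg.
move=> j; rewrite -[LHS]/(if j == reg s4 r_j1 then reg s4 r_ok else cells s4
  a_sel j).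
by rewrite gj gsel eok /chosen eg odd_double.
Qed.

Lemma select_conclusionP s r : loaded s -> reg s r_premise = r.*2 ->
  reg s r_conclusion = r.*2.+1 ->
  decided (fun _ g => g < r.*2.+1) s ->
  decided (fun _ g => g < r.+1.*2) (den select_conclusion s).
Proof.
move=> ld e0 e1 ds; rewrite doubleS; set g := r.*2 in e0 e1 ds *.
pose I (p : seq (nat * nat)) s' := [/\ reg s' r_premise = g,
  reg s' r_conclusion = g.+1 &
  decided (fun j g' => (g' < g.+1) || (g' == g.+1) && (j < size p)) s'].
suff [_ _] : I its (den select_conclusion s).
  by move=> d; apply: (decided_sub _ d) => j g' jl;
    rewrite ltnS leq_eqVlt jl andbT orbC.
apply: (each_ind (I := I)) => //.
- by move=> r'; rewrite !inE => /or3P[] /eqP ->.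
- by split=> //; apply: (decided_sub _ ds) => j g' _; rewrite andbF orbF.
move=> p i q s' eits ld' ej ea ex [f0 f1 Ip].
apply: if_eq_ind => // v w y s1; rewrite ea f1 => eg; last first.
  split=> //; rewrite size_rcons; exact: decided_skip eits eg Ip.
pose s2 := set_reg s1 r_b (reg s1 r_x1 + reg s1 r_zero).
pose s3 := set_reg s2 r_good 1.
have ez : reg s' r_zero = 0 by case: ld' => _ _ _ [].
have eb : reg s3 r_b = i.2 by rewrite -[LHS]/(reg s' r_x1 + reg s' r_zero)
  ex ez addn0.
have ld3 : loaded s3 by [].
pose loop := each r_j2 r_a2 r_x2 (if_eq r_a2 r_premise check_premise).
have -> : den (Plus r_b r_x1 r_zero ;; Const r_good 1 ;; loop ;;
  Store a_sel r_j1 r_good) s1 =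
  den (Store a_sel r_j1 r_good) (den loop s3) by rewrite 3!den_seq.
pose J (p' : seq (nat * nat)) s'' := [/\ reg s'' r_premise = g,
  reg s'' r_conclusion = g.+1,
  reg s'' r_b = i.2, forall j, cells s'' a_sel j = cells s' a_sel j &
  reg s'' r_good = all (fun k => (k.1 == g) && kept_closed g k.2 k.2 ==>
                    kept_closed g k.2 i.2) p'].
have [_ _ _ esel egood] : J its (den loop s3).
  apply: (each_ind (I := J)) => //.
    by move=> r'; rewrite !inE => /or3P[] /eqP ->.
  move=> p' k q' t' eits' ld4 ej2 ea2 ex2 [k0 k1 kb ksel kgood].
  apply: if_eq_ind => // v' w' y' t1; rewrite ea2 k0 => ek; last first.
    by split=> //; rewrite all_rcons; move/eqP/negbTE: ek => ->.
  pose t2 := set_reg t1 r_u (cells t1 a_sel (reg t1 r_j2)).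
  pose c := Plus r_k r_x2 r_zero ;; test ;; Unless r_ok (Const r_good 0).
  rewrite -[den _ _]/(den (if_one r_u c) t2).
  have eu : reg t2 r_u = kept_closed g k.2 k.2.
    rewrite /t2 reg_set -[LHS]/(cells t' a_sel (reg t' r_j2)) ej2 ksel Ip.
    - by rewrite eits' nth_cat ltnn subnn /chosen ek odd_double.
    - by rewrite eits' size_cat /= addnS ltnS leq_addr.
    - by rewrite eits' nth_cat ltnn subnn /= ek ltnSn.
  have eone : reg t2 r_one = 1 by case: ld4 => _ _ _ [].
  apply: (if_one_ind eone eu) => v'' kk; last first.
    by split=> //; rewrite all_rcons (negbTE kk) andbF.
  pose t3 := set_reg t2 r_t v''.
  pose t4 := set_reg t3 r_k (reg t3 r_x2 + reg t3 r_zero).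
  have -> : den c t3 = den (Unless r_ok (Const r_good 0)) (den test t4).
    by rewrite /c 2!den_seq.
  rewrite den_unless.
  have ld5 : loaded t4 by [].
  have := testP ld5 (g := g) k0 k1; rewrite -[reg t4 r_b]/(reg t' r_b) kb.
  rewrite -[reg t4 r_k]/(reg t' r_x2 + reg t' r_zero) ex2.
  have -> : reg t' r_zero = 0 by case: ld4 => _ _ _ [].
  rewrite addn0 => eok.
  have J' : J p' (den test t4).
    split; rewrite /reg ?den_frame //.
    by move=> j; rewrite den_frame // -ksel.
  move: (den test t4) J' eok => t5 [K0 K1 Kb Ksel Kgood] ->; rewrite lt0b.
  case: ifPn => kc; split=> //; rewrite all_rcons ek eqxx kk /=.
    by rewrite kc.
  by rewrite (negbTE kc).
have gj : reg (den loop s3) r_j1 = size p by rewrite /reg den_frame.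
have gh0 : reg (den loop s3) r_premise = g by rewrite /reg den_frame.
have gh1 : reg (den loop s3) r_conclusion = g.+1 by rewrite /reg den_frame.
move: (den loop s3) gj gh0 gh1 esel egood => s4 gj gh0 gh1 esel egood;
  split=> //.
rewrite size_rcons -eg; apply: (decided_store (s := s') eits);
  last by rewrite eg.
move=> j; rewrite -[LHS]/(if j == reg s4 r_j1 then reg s4 r_good else cells s4
  a_sel j).
by rewrite gj esel egood /chosen eg /= odd_double.
Qed.

Lemma selectP s : loaded s -> decided (fun _ g => g < m.*2) (den select s).
Proof.
move=> ld; have [em _ _ _ _] := ld.
pose I k s' := [/\ loaded s', reg s' r_premise = k.*2 &
  decided (fun _ g => g < k.*2) s'].
suff [_ _] : I (reg s r_rows) (den select s) by rewrite em.
pose body := Plus r_conclusion r_premise r_one ;; select_premise ;;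
  select_conclusion ;; Plus r_premise r_conclusion r_one.
apply: (@loop_ind I r_rows body (set_reg s r_premise 0)) => //.
move=> k s' km [ld' e0 dk].
pose s1 := set_reg s' r_conclusion (reg s' r_premise + reg s' r_one).
have eone : reg s' r_one = 1 by case: ld' => _ _ _ [].
have ld1 : loaded s1 by [].
have e1 : reg s1 r_conclusion = k.*2.+1 by rewrite /s1 reg_set e0 eone addn1.
have ld2 : loaded (den select_premise s1) by apply: loaded_frame.
have d2 := select_premiseP (r := k) ld1 e0 e1 dk.
have d3 : decided (fun _ g => g < k.+1.*2)
  (den select_conclusion (den select_premise s1)).
  by apply: select_conclusionP => //; rewrite /reg den_frame.
set s3 := den select_conclusion _ in d3.
have ld3 : loaded s3 by apply: loaded_frame.
rewrite -[den _ _]/(set_reg s3 r_premise (reg s3 r_conclusion + reg s3 r_one)).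
split=> //; rewrite reg_set.
have -> : reg s3 r_one = 1 by case: ld3 => _ _ _ [].
by rewrite /reg !den_frame // -/(reg s1 r_conclusion) e1 addn1 doubleS.
Qed.

Definition selected g := [seq i.2 | i <- its & (i.1 == g) && chosen i].

Lemma for_selectedP (I : seq (nat * nat) -> state -> Prop) c s g :
  keeps_data c -> ~~ touches c 0 r_premise -> ~~ touches c 0 r_j1 ->
    ~~ touches c a_sel 0 ->
  (forall r, r \in [:: r_t; r_u; r_j1; r_a1; r_x1] ->
     forall p s' v, I p s' -> I p (set_reg s' r v)) ->
  loaded s -> decided (fun _ _ => true) s -> reg s r_premise = g ->
  I [::] s ->
  (forall p i s', reg s' r_one = 1 -> reg s' r_x1 = i.2 ->
    (i.1 == g) && chosen i ->
     I p s' -> I (rcons p i) (den c s')) ->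
  (forall p i s', ~~ ((i.1 == g) && chosen i) -> I p s' -> I (rcons p i) s') ->
  I its (den (for_selected c) s).
Proof.
move=> kd nh nj ns stab ld ds e0 I0 yes no.
pose J p s' := [/\ reg s' r_premise = g, decided (fun _ _ => true) s' & I p s'].
suff [] : J its (den (for_selected c) s) by [].
apply: (each_ind (I := J)) => //.
  move=> r rin p s' v [f0 d Ip]; split=> //; last first.
    by apply: stab => //; move: rin; rewrite !inE => /or3P[] /eqP ->.
  by move: rin; rewrite !inE => /or3P[] /eqP ->.
move=> p i q s' eits ld' ej ea ex [f0 d Ip].
have st r v p' s1 : (r == r_t) || (r == r_u) -> J p' s1 ->
  J p' (set_reg s1 r v).
  move=> rt [g0 g1 g2]; split=> //; last first.
    by apply: stab => //; rewrite !inE orbA rt.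
  by case/orP: rt => /eqP ->.
have J0 : J p s' by [].
apply: if_eq_ind => // v w y s1; rewrite ea f0 => eg.
  pose s2 := set_reg s1 r_u (cells s1 a_sel (reg s1 r_j1)).
  have J2 : J p s2 by do 4!(apply: (st) => //).
  rewrite -[den _ _]/(den (if_one r_u c) s2).
  have eu : reg s2 r_u = chosen i.
    rewrite /s2 reg_set -[LHS]/(cells s' a_sel (reg s' r_j1)) ej d //.
      by rewrite eits nth_cat ltnn subnn.
    by rewrite eits size_cat /= addnS ltnS leq_addr.
  have eone : reg s2 r_one = 1 by case: ld' => _ _ _ [].
  apply: (if_one_ind eone eu) => v' ci; last first.
    have [g0 g1 g2] : J p (set_reg s2 r_t v') by apply: st.
    by split=> //; apply: no => //; rewrite (negbTE ci) andbF.
  have [g0 g1 g2] : J p (set_reg s2 r_t v') by apply: st.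
  split; first by rewrite /reg den_frame.
    by move=> j jl Dj; rewrite den_frame ?(touches_array _ _ 0) //; apply: g1.
  by apply: yes => //; rewrite eg eqxx.
have [g0 g1 g2] : J p s1 by do 3!(apply: (st) => //).
by split=> //; apply: no => //; move/eqP/negbTE: eg => ->.
Qed.

Lemma writeP s : loaded s -> decided (fun _ _ => true) s -> output s = [::] ->
  output (den write s) =
  m :: flatten [seq size (selected g) :: selected g | g <- iota 0 m.*2].
Proof.
move=> ld ds o0; have [em eh _ _ _] := ld.
pose I k s' := [/\ loaded s', decided (fun _ _ => true) s',
  reg s' r_premise = k &
  output s' = m :: flatten [seq size (selected g)
    :: selected g | g <- iota 0 k]].
suff [] : I (reg s r_halves) (den write s) by rewrite eh.
pose count := for_selected (Plus r_count r_count r_one).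
pose print := for_selected (Print r_x1).
pose body := Const r_count 0 ;; count ;; Print r_count ;; print ;;
  Plus r_premise r_premise r_one.
pose s0 := set_reg (den (Print r_rows) s) r_premise 0.
apply: (@loop_ind I r_halves body s0).
  by split=> //; rewrite -[output _]/(rcons (output s) (reg s r_rows)) o0 em.
move=> k s' _ [ld' d' e0 out'];
pose s1 := set_reg s' r_count 0.
have ld1 : loaded s1 by [].
pose I1 (p : seq (nat * nat)) s'' :=
  reg s'' r_count = size [seq i.2 | i <- p & (i.1 == k) && chosen i].
have c2 : reg (den count s1) r_count = size (selected k).
  apply: (@for_selectedP I1 _ _ k) => //.
  - by move=> r; rewrite !inE => /or4P[||| /orP[]] /eqP ->.
  - move=> p i s'' e1 _ ci; rewrite /I1 filter_rcons ci map_rcons size_rcons =>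
      <-.
    by rewrite -[LHS]/(reg s'' r_count + reg s'' r_one) e1 addn1.
  - by move=> p i s'' ci; rewrite /I1 filter_rcons (negbTE ci).
set s2 := den count s1 in c2.
have ld2 : loaded s2 by apply: loaded_frame.
have d2 : decided (fun _ _ => true) s2.
  by move=> j jl Dj; rewrite /s2 den_frame //; apply: d'.
have o2 : output s2 = output s' by apply: den_output.
pose s3 := den (Print r_count) s2.
have e3 : reg s3 r_premise = k by rewrite -[LHS]/(reg s2 r_premise)
  /reg den_frame.
pose I2 (p : seq (nat * nat)) s'' :=
  output s'' = output s3 ++ [seq i.2 | i <- p & (i.1 == k) && chosen i].
have o4 : output (den print s3) = output s3 ++ selected k.
  apply: (@for_selectedP I2 _ _ k) => //.
  - by rewrite /I2 cats0.
  - move=> p i s'' e1 ex ci; rewrite /I2 filter_rcons ci map_rcons -rcons_cat =>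
      <-.
    by rewrite -ex.
  - by move=> p i s'' ci; rewrite /I2 filter_rcons (negbTE ci).
set s4 := den print s3 in o4.
have ld4 : loaded s4 by apply: loaded_frame.
rewrite -[den _ _]/(set_reg s4 r_premise (reg s4 r_premise + reg s4 r_one)).
split=> //.
- by move=> j jl Dj; rewrite -[cells _ _ _]/(cells s4 a_sel j) /s4 den_frame //;
    apply: d2.
- rewrite reg_set; have -> : reg s4 r_one = 1 by case: ld4 => _ _ _ [].
  by rewrite /reg den_frame // -/(reg s3 r_premise) e3 addn1.
rewrite -[LHS]/(output s4) o4 -[output s3]/(rcons (output s2) (reg s2 r_count)).
by rewrite c2 o2 out' -addn1 iotaD map_cat flatten_cat /= cats0 -cats1 -!catA.
Qed.

End Loaded.

Fixpoint items_from (g : nat) (hs : seq (seq nat)) : seq (nat * nat) :=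
  if hs is s :: hs' then [seq (g, x) | x <- s] ++ items_from g.+1 hs' else [::].

Definition encode_half (s : seq nat) := size s :: s.

Lemma items_from_rcons g hs s :
  items_from g (rcons hs s) = items_from g hs ++ [seq (g + size hs,
    x) | x <- s].
Proof.
elim: hs g => [|s' hs IH] g /=; first by rewrite addn0 cats0.
by rewrite IH catA addSnnS.
Qed.

Lemma items_from_lt g hs i : i \in items_from g hs -> i.1 < g + size hs.
Proof.
elim: hs g => //= s hs IH g; rewrite mem_cat addnS -addSn.
by case/orP=> [/mapP[x _ ->] | /IH //]; rewrite /= leq_addr.
Qed.

Definition stored (p : seq (nat * nat)) (s : state) : Prop :=
  [/\ reg s r_items = size p, reg s r_one = 1, reg s r_zero = 0
    & forall j, j < size p -> (cells s a_half j, cells s a_elt j) = nth (0,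
      0) p j].

Lemma read_itemP p s x w : stored p s -> input s = x :: w ->
  stored (rcons p (reg s r_half, x)) (den read_item s)
    /\ input (den read_item s) = w.
Proof.
case=> e1 e2 e3 e4 ei; pose s1 := den (Read r_x1) s.
have in1 : input s1 = w by rewrite -[LHS]/(behead (input s)) ei.
split=> //; split=> //.
- by rewrite -[LHS]/(reg s r_items + reg s r_one) e1 e2 size_rcons addn1.
move=> j; rewrite size_rcons ltnS => jp.
rewrite -[cells _ a_half j]/(if j == reg s r_items then reg s r_half else cells
  s a_half j).
rewrite -[cells _ a_elt j]/(if j == reg s r_items then head 0 (input s)
  else cells s a_elt j).
rewrite e1 ei nth_rcons; move: jp; rewrite leq_eqVlt; case: eqP => [->|_] /=.
  by rewrite ltnn.
by move=> jp; rewrite jp e4.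
Qed.

Lemma read_itemsP k p s x w : stored p s -> input s = x ++ w -> k <= size x ->
  let s' := iter k (den read_item) s in
  [/\ stored (p ++ [seq (reg s r_half, y) | y <- take k x]) s',
    reg s' r_half = reg s r_half,
      reg s' r_rows = reg s r_rows /\ reg s' r_halves = reg s r_halves
    & input s' = drop k x ++ w /\ output s' = output s].
Proof.
move=> st ei; elim: k => [|k IH] kx s2; first by rewrite take0 cats0 drop0.
have [] := IH (ltnW kx); rewrite /s2 iterS;
  move: (iter k _ s) => s' st' eh [er eh'] [ei' eo].
rewrite (drop_nth 0 kx) /= in ei'.
have [st'' ei''] := read_itemP st' ei'.
split; last by split.
- by rewrite (take_nth 0 kx) map_rcons -rcons_cat -{2}eh.
- by rewrite -eh; apply: den_frame.
- by rewrite -er -eh'; split; apply: den_frame.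
Qed.

Definition read_half := Read r_len ;; Repeat r_len read_item ;;
  Plus r_half r_half r_one.

Definition read_state (hs : seq (seq nat)) m k (s : state) : Prop :=
  [/\ stored (items_from 0 (take k hs)) s, reg s r_half = k,
      reg s r_rows = m /\ reg s r_halves = m.*2
    & input s = flatten [seq encode_half x | x <- drop k hs] /\ output s =
      [::]].

Lemma read_halfP hs m k s : k < size hs -> read_state hs m k s ->
  read_state hs m k.+1 (den read_half s).
Proof.
move=> kh [st eh [er eh'] [ei eo]].
rewrite (drop_nth [::] kh) /= in ei; set x := nth [::] hs k in ei.
pose s1 := den (Read r_len) s.
have el : reg s1 r_len = size x by rewrite -[LHS]/(head 0 (input s)) ei.
have ei1 : input s1 = x ++ flatten [seq encode_half x | x <- drop k.+1 hs].
  by rewrite -[LHS]/(behead (input s)) ei.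
have st1 : stored (items_from 0 (take k hs)) s1 by [].
have -> : den read_half s =
    den (Plus r_half r_half r_one) (iter (reg s1 r_len) (den read_item) s1)
      by [].
rewrite el; have [] := read_itemsP st1 ei1 (leqnn (size x)).
move: (iter _ _ _) => s2; rewrite -[reg s1 r_half]/(reg s r_half)
  eh drop_size take_size.
move=> st2 eh2 [er2 eh2'] [ei2 eo2].
have e1 : reg s2 r_one = 1 by case: st2.
split=> //.
- by rewrite (take_nth [::] kh) items_from_rcons add0n size_take kh.
- by rewrite -[LHS]/(reg s2 r_half + reg s2 r_one) eh2 e1 addn1.
- by split; [apply: etrans er2 er | apply: etrans eh2' eh'].
- by split=> //; apply: etrans eo2 eo.
Qed.

Definition initial w := State (fun _ _ => 0) w [::].

Lemma readP m hs : size hs = m.*2 ->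
  let s := den read (initial (m :: flatten [seq encode_half x | x <- hs])) in
  [/\ loaded m (items_from 0 hs) s & output s = [::]].
Proof.
move=> sz; set s0 := initial _.
pose s1 := set_reg (den (Const r_one 1) (den (Read r_rows) s0))
  r_halves (m + m).
rewrite -[den read s0]/(den (Repeat r_halves read_half) s1).
have I0 : read_state hs m 0 s1.
  by split; rewrite ?take0 ?drop0 //; split=> //; rewrite -[LHS]/(m + m) addnn.
have em : reg s1 r_halves = m.*2 by case: I0 => _ _ [].
have : read_state hs m m.*2 (den (Repeat r_halves read_half) s1).
  rewrite -em; apply: loop_ind => // k s; rewrite em => km.
  by apply: read_halfP; rewrite sz.
rewrite -sz /read_state take_size; case=> -[e1 e2 e3 e4] _ [e5 e6] [_ e7].
by split=> //; split=> //; rewrite e6 sz.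
Qed.

Lemma read_bounded B m hs : size hs = m.*2 -> m.*2 <= B ->
  (forall x, x \in hs -> size x <= B) ->
  bounded B read (initial (m :: flatten [seq encode_half x | x <- hs])).
Proof.
move=> sz mB hB; set s0 := initial _.
pose s1 := set_reg (den (Const r_one 1) (den (Read r_rows) s0))
  r_halves (m + m).
have I0 : read_state hs m 0 s1.
  by split; rewrite ?take0 ?drop0 //; split=> //; rewrite -[LHS]/(m + m) addnn.
have em : reg s1 r_halves = m.*2 by case: I0 => _ _ [].
suff : bounded B (Repeat r_halves read_half) s1 by [].
split; rewrite em // => k km.
have Ik : read_state hs m k (iter k (den read_half) s1).
  elim: k km => // k IH km; rewrite iterS; apply: read_halfP;
    last exact/IH/ltnW.
  by rewrite sz ltnW.
set s := iter k _ _ in Ik *; case: Ik => _ _ _ [ei _].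
split=> //; split=> //; split=> //.
rewrite -[reg _ _]/(head 0 (input s)) ei (drop_nth [::]) ?sz //=.
by apply: hB; rewrite mem_nth ?sz.
Qed.

Lemma prune_programP m hs B : size hs = m.*2 -> m.*2 <= B ->
  size (items_from 0 hs) <= B -> (forall x, x \in hs -> size x <= B) ->
  let its := items_from 0 hs in
  outputs_within (assemble prune_program)
    (m :: flatten [seq encode_half x | x <- hs]) (cost_poly prune_program).[B]%R
    (m :: flatten [seq encode_half (selected m its g) | g <- iota 0 m.*2]).
Proof.
move=> sz mB iB hB its; set w := m :: flatten [seq encode_half x | x <- hs].
have [ld o1] := readP sz; rewrite -/w in ld o1; set s1 := den read _ in ld o1.
pose s2 := den select s1.
have ld2 : loaded m its s2 by apply: loaded_frame.
have d2 : decided m its (fun _ _ => true) s2.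
  move=> j jl _; apply: (selectP ld) => //.
  by rewrite -sz -[size hs]add0n items_from_lt // mem_nth.
have o2 : output s2 = [::] by rewrite /s2 den_output.
rewrite -(writeP ld2 d2 o2).
apply: (@assemble_correct prune_program w B wf_prune).
split; first exact: read_bounded.
have [e1 e2 e3 _ _] := ld.
apply: (@bounded_loops B [pred r | r < 3]) => //.
move=> [|[|[|r]]] // _; rewrite ?e1 ?e2 ?e3; split=> //.
by apply: leq_trans mB; rewrite -addnn leq_addr.
Qed.

(** * The program computes the optimum basis *)

Lemma items_from_ge g hs i : i \in items_from g hs -> g <= i.1.
Proof.
elim: hs g => //= s hs IH g; rewrite mem_cat.
by case/orP=> [/mapP[x _ ->] // | /IH/ltnW].
Qed.

Lemma half_items hs g :
  [seq i.2 | i <- items_from 0 hs & i.1 == g] = nth [::] hs g.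
Proof.
rewrite -[RHS]/(nth [::] hs g) -{1}[g]add0n.
elim: hs 0 g => [|s hs IH] g0 g /=; first by rewrite nth_nil.
rewrite filter_cat map_cat; case: g => [|g] /=.
  rewrite addn0 (@eq_in_filter _ _ predT) ?filter_predT; last first.
    by move=> _ /mapP[x _ ->] /=; rewrite eqxx.
  rewrite -map_comp map_id (@eq_in_filter _ _ pred0) ?filter_pred0 ?cats0 //.
  by move=> i /items_from_ge/gtn_eqF.
rewrite (@eq_in_filter _ _ pred0) ?filter_pred0 /=.
  by rewrite -addSnnS IH.
by move=> _ /mapP[x _ ->] /=; rewrite ltn_eqF // addnS ltnS leq_addr.
Qed.

Lemma size_half_items hs s g : s \in hs -> size s <= size (items_from g hs).
Proof.
elim: hs g => //= s' hs IH g; rewrite size_cat size_map inE.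
case/predU1P=> [-> | /IH le]; first exact: leq_addr.
exact: leq_trans (le g.+1) (leq_addl _ _).
Qed.

Lemma all_items hs g (a : pred nat) :
  all (fun i => (i.1 == g) ==> a i.2) (items_from 0 hs) = all a (nth [::] hs g).
Proof. by rewrite -half_items all_map all_filter. Qed.

Lemma mem_items hs g x :
  has (fun i => (i.1 == g) && (i.2 == x)) (items_from 0 hs) =
    (x \in nth [::] hs g).
Proof.
rewrite -half_items -has_pred1 has_map.
by elim: (items_from 0 hs) => //= i s ->; case: (i.1 == g).
Qed.

Lemma selectedE m hs g :
  selected m (items_from 0 hs) g =
  [seq x <- nth [::] hs g | chosen m (items_from 0 hs) (g, x)].
Proof.
rewrite -half_items filter_map -filter_predI /selected; congr map.
apply: eq_filter => -[g' x] /=; rewrite andbC.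
by case: eqP => [->|]; rewrite ?andbF.
Qed.

Lemma subset_seq_set (T : finType) (s : seq T) (Z : {set T}) :
  ([set:: s] \subset Z) = all (fun x => x \in Z) s.
Proof.
by apply/subsetP/allP => H x xs; apply: H; move: xs; rewrite inE.
Qed.

Section Encoding.

Variable G : finType.
Implicit Types (l : seq (seq G * seq G)) (p : seq G * seq G) (x k b : G).

Definition rank x : nat := enum_rank x.

Lemma rank_inj : injective rank.
Proof. by move=> x y /val_inj/enum_rank_inj. Qed.

Definition halves_of l : seq (seq nat) :=
  flatten [seq [:: map rank p.1; map rank p.2] | p <- l].

Lemma encode_halves l :
  encode l = size l :: flatten [seq encode_half s | s <- halves_of l].
Proof.
rewrite /encode; congr cons; elim: l => //= p l ->.
by rewrite /encode_seq /encode_half !size_map /= -!catA.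
Qed.

Lemma size_halves_of l : size (halves_of l) = (size l).*2.
Proof. by elim: l => //= p l ->. Qed.

Lemma nth_halves_of l i : i < size l ->
  nth [::] (halves_of l) i.*2 = map rank (nth ([::], [::]) l i).1 /\
  nth [::] (halves_of l) i.*2.+1 = map rank (nth ([::], [::]) l i).2.
Proof. by elim: l i => //= p l IH [|i] //= /IH. Qed.

Definition support p : {set G} := [set:: p.1] :|: [set:: p.2].

(** For a listing of the canonical basis this says that [Z] is closed. *)
Definition respects_list l (Z : {set G}) :=
  all (fun p => ([set:: p.1] \subset Z) ==> ([set:: p.2] \subset Z)) l.

Variable l : seq (seq G * seq G).
Let its := items_from 0 (halves_of l).
Let m := size l.

Lemma keepE i k b x : i < m ->
  keep its i.*2 (rank k) (rank b) (rank x) =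
  (x \in support (nth ([::], [::]) l i) :\ k :\ b).
Proof.
move=> im; have [e1 e2] := nth_halves_of im.
rewrite /keep (@eq_has _ _ (predU (fun j => (j.1 == i.*2) && (j.2 == rank x))
   (fun j => (j.1 == i.*2.+1) && (j.2 == rank x)))); last first.
  by move=> j /=; rewrite andb_orl.
rewrite has_predU !mem_items e1 e2 !mem_map; try exact: rank_inj.
rewrite !(inj_eq rank_inj) !inE.
by case: (x == k); case: (x == b); rewrite ?andbF ?andbT.
Qed.

Lemma kept_closedE i k b : i < m ->
  kept_closed m its i.*2 (rank k) (rank b) =
  respects_list l (support (nth ([::], [::]) l i) :\ k :\ b).
Proof.
move=> im; set Z := _ :\ b.
have hk r : r < m ->
  half_kept its i.*2 (rank k) (rank b) r.*2 =
    ([set:: (nth ([::], [::]) l r).1] \subset Z) /\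
  half_kept its i.*2 (rank k) (rank b) r.*2.+1 =
    ([set:: (nth ([::], [::]) l r).2] \subset Z).
  move=> rm; have [e1 e2] := nth_halves_of rm.
  rewrite /half_kept !all_items e1 e2 !all_map.
  by rewrite !subset_seq_set; split; apply: eq_all => x; rewrite /= keepE.
rewrite /respects_list -{1}(mkseq_nth ([::], [::]) l) /mkseq all_map.
apply: eq_in_all => r; rewrite mem_iota add0n => /andP[_ rm].
by have [-> ->] := hk r rm.
Qed.

(** The effect of the program on one listed implication: [prune] on lists, with
the closedness of a set expressed through the listing. *)
Definition prune_lists p : seq G * seq G :=
  ([seq k <- p.1 | respects_list l (support p :\ k :\ k)],
   [seq b <- p.2 | all (fun k => respects_list l (support p :\ k :\ k) ==>
                               respects_list l (support p :\ k :\ b)) p.1]).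

(** Decoding the items of a half gives back the list of its elements, so the
selection rule on items becomes the filtering of [prune_lists]. *)
Lemma output_lists :
  m :: flatten [seq encode_half (selected m its g) | g <- iota 0 m.*2] =
  encode (map prune_lists l).
Proof.
rewrite encode_halves size_map; congr (_ :: flatten _).
rewrite map_comp; congr map.
apply: (@eq_from_nth _ [::]); first by rewrite size_map size_iota size_halves_of
  size_map.
move=> g; rewrite size_map size_iota => gm.
rewrite (nth_map 0) ?size_iota // nth_iota // add0n selectedE.
have im : g./2 < m by move: gm; lia.
have im' : g./2 < size (map prune_lists l) by rewrite size_map.
have [e1 e2] := nth_halves_of im; have [f1 f2] := nth_halves_of im'.
rewrite (nth_map ([::], [::])) // in f1 f2.
rewrite -[g]odd_double_half; case: (odd g); rewrite ?add1n ?add0n.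
  rewrite e2 f2 filter_map; congr map; apply: eq_filter => b.
  rewrite /= /chosen /= odd_double /=.
  transitivity (all (fun k : nat => kept_closed m its g./2.*2 k k ==>
      kept_closed m its g./2.*2 k (rank b)) (nth [::] (halves_of l) g./2.*2)).
    rewrite -all_items; by apply: eq_all => k /=; case: (k.1 == _).
  by rewrite e1 all_map; apply: eq_all => k /=; rewrite !kept_closedE.
rewrite e1 f1 filter_map; congr map; apply: eq_filter => k.
by rewrite /= /chosen /= odd_double /= kept_closedE.
Qed.

End Encoding.

Section Correct.

Variables (G : finType) (phi : {set G} -> {set G}) (l : seq (seq G * seq G)).
Hypotheses (geo : convex_geometry phi) (cl : listing (canonical_basis phi) l).

Definition to_sets (p : seq G * seq G) : implication G := ([set:: p.1],
  [set:: p.2]).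

Lemma respects_listE Z : respects_list l Z = closed_set phi Z.
Proof.
case: cl => _ _ el; rewrite canonical_basisP // /respects_list.
apply/allP/forall_inP => [H i | H p pl].
  by rewrite -el => /mapP[p pl ->]; apply: H.
by apply: (H (to_sets p)); rewrite -el; apply: map_f.
Qed.

Lemma listed_critical p : p \in l ->
  critical phi [set:: p.1] /\ [set:: p.2] = phi [set:: p.1] :\: [set:: p.1].
Proof.
case: cl => _ _ el pl.
have : to_sets p \in canonical_basis phi by rewrite -el; apply: map_f.
by case/imsetP=> C; rewrite inE => cC [-> ->].
Qed.

Lemma prune_listsE p : p \in l ->
  to_sets (prune_lists l p) = prune phi [set:: p.1].
Proof.
move=> pl; have [cC eD] := listed_critical pl.
have eE : support p = phi [set:: p.1].
  rewrite /support eD; apply/setP => x; rewrite !inE;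
    case: (boolP (x \in p.1)) => //= xp.
  by case: geo => -[/(_ [set:: p.1])/subsetP/(_ x)]; rewrite inE xp => ->.
have D1 k : phi [set:: p.1] :\ k :\ k = phi [set:: p.1] :\ k.
  by apply/setP => x; rewrite !inE; case: (x == k).
rewrite /to_sets /prune_lists eE /prune; congr pair; apply/setP => x.
  by rewrite !inE mem_filter respects_listE D1 andbC.
rewrite -eD [LHS]inE mem_filter andbC [RHS]inE; congr andb;
  first by rewrite inE.
apply/allP/forall_inP => H k.
  rewrite !inE => /andP[kp ck]; have := H k kp.
  by rewrite !respects_listE D1 ck.
move=> kp; have := H k; rewrite !inE kp !respects_listE D1 /=.
by move=> H'; apply/implyP.
Qed.

Lemma listing_prune : listing (pruned_basis phi) (map (prune_lists l) l).
Proof.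
case: (cl) => ul sl el.
have eP : [seq to_sets p | p <- map (prune_lists l) l] =
   [seq prune phi i.1 | i <- map to_sets l].
  by rewrite -!map_comp; apply/eq_in_map => p /prune_listsE.
split.
- rewrite all_map; apply: sub_all ul => p /= /andP[u1 u2].
  by rewrite !filter_uniq.
- rewrite -/(map to_sets _) eP map_inj_in_uniq // => i j.
  rewrite !el => /imsetP[C cC ->] /imsetP[C' cC' ->] /= e.
  rewrite !inE in cC cC'.
  by rewrite (prune_inj geo cC cC' e).
move=> i; rewrite -/(map to_sets _) eP; apply/mapP/imsetP => [[j] | [C cC ->]].
  by rewrite el => /imsetP[C cC ->] ->; exists C => //; move: cC; rewrite inE.
by exists (C, phi C :\: C); rewrite // el; apply/imsetP; exists C; rewrite ?inE.
Qed.

Lemma basis_size_listing :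
  basis_size (canonical_basis phi) = \sum_(p <- l) (size p.1 + size p.2).
Proof.
case: cl => /allP ul sl el; rewrite /basis_size.
transitivity (\sum_(i <- map to_sets l) (#|i.1| + #|i.2|)).
  by rewrite big_uniq //; apply: eq_bigl => i; rewrite el.
rewrite big_map; apply: eq_big_seq => p /ul /andP[u1 u2].
by rewrite /= !cardsE !(card_uniqP _).
Qed.

Lemma size_items_listing :
  size (items_from 0 (halves_of l)) = basis_size (canonical_basis phi).
Proof.
rewrite basis_size_listing; elim: l {1}0 => [|p s IH] g /=.
  by rewrite big_nil.
by rewrite big_cons !size_cat !size_map IH addnA.
Qed.

(** Both sides of a listed implication are nonempty, so the number of halves,
which bounds the loops over implications, is at most the size of the basis. *)
Lemma size_listing : (size l).*2 <= basis_size (canonical_basis phi).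
Proof.
rewrite basis_size_listing -muln2 -sum1_size big_distrl /=.
rewrite big_seq [X in _ <= X]big_seq; apply: leq_sum => p pl.
have [/andP[/andP[nc _] _] eD] := listed_critical pl.
apply: (@leq_add 1 1).
  case: p.1 nc {pl eD} => // /negP[]; case: geo => _ phi0 _.
  by rewrite /closed_set set_nil phi0.
case: p.2 eD {pl} => //; rewrite set_nil => /esym/eqP.
rewrite setD_eq0 => sC; case/negP: nc; rewrite /closed_set eqEsubset sC.
by rewrite andTb; case: geo => -[+ _ _] _ _; apply.
Qed.

End Correct.

Theorem corollary24 :
  exists (P : program) (p : {poly nat}),
    forall (G : finType) (phi : {set G} -> {set G}),
      D_geometry phi ->
      forall w : seq nat, represents w (canonical_basis phi) ->
        exists (v : seq nat) (Sigma : {set implication G}),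
          [/\ outputs_within P w (p.[basis_size (canonical_basis phi)])%R v,
              represents v Sigma
            & optimum_basis phi Sigma].
Proof.
exists (assemble prune_program), (cost_poly prune_program) =>
  G phi [geo acy] w [l cl ->].
exists (encode (map (prune_lists l) l)), (pruned_basis phi); split.
- rewrite -output_lists encode_halves; apply: prune_programP.
  + exact: size_halves_of.
  + exact: size_listing.
  + by rewrite (size_items_listing cl).
  + by move=> s sl; rewrite -(size_items_listing cl); apply: size_half_items.
- by exists (map (prune_lists l) l) => //; apply: listing_prune.
- exact: pruned_basis_optimum.
Qed.
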